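(* Set $c_*:=\log\cosh(1/2)>0$. There is a universal constant $C>0$ such that the following holds for every integer $d\ge3$, every real symmetric matrix $K=(K_{ij})_{1\le i,j\le d-1}$ with $K_{ii}=0$ for all $i$ and $\max_{1\le i\le d-1}\sum_{j\ne i}|K_{ij}|\le\frac12$, and every finite $\beta\ge1$. With $P_\beta$ and $G$ as defined in the context, $$t_{\mathrm{mix}}(P_\beta,1/4)\ge (d-1)(\log 2)\,e^{c_*\beta(d-1)},$$ $$\max\left\{t_{\mathrm{mix}}(GP_\beta G,1/4),\ t_{\mathrm{mix}}\left(\tfrac12(P_\beta+G),1/4\right)\right\}\le C\,d^2(1+\beta).$$ (The constant $C$ does not depend on $d$, $\beta$ or $K$.)
   Context: State space and target: $\mathcal X=\{-1,+1\}^d$, with configurations written $x=(x_0,x_1,\ldots,x_{d-1})$. The Hamiltonian is $$H(x)=-x_0\sum_{i=1}^{d-1}x_i-\sum_{1\le i<j\le d-1}K_{ij}x_ix_j,$$ and $\pi_\beta(x)=e^{-\beta H(x)}/\mathcal Z_\beta$ with $\mathcal Z_\beta=\sum_{x\in\mathcal X}e^{-\beta H(x)}$. Lazy Metropolis kernel: for $0\le i\le d-1$, $x^{(i)}$ denotes $x$ with the spin at index $i$ reversed. The kernel $P_\beta$ on $\mathcal X$ has $P_\beta(x,x^{(i)})=\frac{1}{2d}\min\{1,e^{-\beta[H(x^{(i)})-H(x)]}\}$ for $0\le i\le d-1$, $P_\beta(x,x)=1-\sum_{i=0}^{d-1}P_\beta(x,x^{(i)})$, and $P_\beta(x,y)=0$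 otherwise. Orbit averaging: $R(x,y)=\mathbf 1_{\{y=-x\}}$ and $G=\frac12(I+R)$, kernels on $\mathcal X$. Kernels are multiplied as matrices. All of $P_\beta$, $GP_\beta G$, $\frac12(P_\beta+G)$ have stationary distribution $\pi_\beta$. Mixing time: for an ergodic kernel $T$ with stationary distribution $\mu$ and $\varepsilon>0$, $t_{\mathrm{mix}}(T,\varepsilon)=\min\{t\in\{0,1,2,\ldots\}:\max_x\|T^t(x,\cdot)-\mu\|_{\mathrm{TV}}\le\varepsilon\}$, where $\|\eta-\mu\|_{\mathrm{TV}}=\frac12\sum_x|\eta(x)-\mu(x)|$. *)

(* Defs.v *)
From mathcomp Require Import all_boot all_order all_algebra.
From mathcomp Require Import reals sequences exp.

Set Implicit Arguments.
Unset Strict Implicit.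
Unset Printing Implicit Defensive.

Import Order.TTheory GRing.Theory Num.Theory.

Local Open Scope ring_scope.

Section Kernels.
Variables (R : realType) (X : finType).

(* Kernels on X are X-indexed square matrices, represented as functions. *)
Definition kernel := X -> X -> R.

Definition kid : kernel := fun x y => (x == y)%:R.

Definition kmul (S T : kernel) : kernel :=
  fun x y => \sum_(z : X) S x z * T z y.

Definition kpow (T : kernel) (t : nat) : kernel := iter t (kmul T) kid.

Definition kmean (S T : kernel) : kernel := fun x y => (S x y + T x y) / 2.

Definition dTV (eta mu : X -> R) : R := 2^-1 * \sum_(x : X) `|eta x - mu x|.

(* Distances are nonnegative, so the default value 0 of the iterated maximum
   is harmless. *)
Definition worst_dTV (T : kernel) (mu : X -> R) (t : nat) : R :=
  \big[Num.max/0]_(x : X) dTV (kpow T t x) mu.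

(* t is the minimum of the set of times at which the worst-case distance to
   mu is at most eps. As a relation it does not hold for any t when
   this set is empty, so asserting it for some t includes the assertion
   that the mixing time is finite. *)
Definition is_mixing_time (T : kernel) (mu : X -> R) (eps : R) (t : nat) : Prop :=
  worst_dTV T mu t <= eps /\
  forall s : nat, worst_dTV T mu s <= eps -> (t <= s)%N.

Lemma is_mixing_time_unique (T : kernel) (mu : X -> R) (eps : R) (s t : nat) :
  is_mixing_time T mu eps s -> is_mixing_time T mu eps t -> s = t.
Proof.
by move=> [sP smin] [tP tmin]; apply/eqP; rewrite eqn_leq smin // tmin.
Qed.

End Kernels.

(* The number of sites is d = n.+1: site 0 is ord0, and the sites 1, ..., d-1
   are the lift ord0 i for i : 'I_n, so that K is an n x n matrix. *)

(* Spin configurations, with true for +1 and false for -1. *)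
Definition config (n : nat) := {ffun 'I_n.+1 -> bool}.

Section Model.
Variables (R : realType) (n : nat) (K : 'M[R]_n) (beta : R).
Implicit Types x y : config n.

Definition spin x (i : 'I_n.+1) : R := if x i then 1 else -1.

Definition flip x (i : 'I_n.+1) : config n :=
  [ffun j => if j == i then ~~ x j else x j].

Definition antipode x : config n := [ffun j => ~~ x j].

Definition hamiltonian x : R :=
  - spin x ord0 * (\sum_(i < n) spin x (lift ord0 i))
  - \sum_(i < n) \sum_(j < n | (i < j)%N)
      K i j * spin x (lift ord0 i) * spin x (lift ord0 j).

Definition partition_function : R :=
  \sum_(x : config n) expR (- beta * hamiltonian x).

Definition gibbs x : R := expR (- beta * hamiltonian x) / partition_function.

Definition metropolis_rate x y : R :=
  (2 * n.+1%:R)^-1 *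
  Num.min 1 (expR (- beta * (hamiltonian y - hamiltonian x))).

Definition metropolis : kernel R (config n) := fun x y =>
  if y == x then 1 - \sum_(i < n.+1) metropolis_rate x (flip x i)
  else if [exists i, y == flip x i] then metropolis_rate x y
  else 0.

Definition antipode_kernel : kernel R (config n) :=
  fun x y => (y == antipode x)%:R.

Definition orbit_average : kernel R (config n) :=
  kmean (@kid R (config n)) antipode_kernel.

End Model.

Arguments antipode_kernel : clear implicits.
Arguments orbit_average : clear implicits.

Definition cosh (R : realType) (x : R) : R := (expR x + expR (- x)) / 2.

Definition c_star (R : realType) : R := ln (cosh (1 / 2)).

(* Main.v *)
Require Import Defs.
From mathcomp Require Import all_boot all_order all_algebra.
From mathcomp Require Import boolp reals sequences exp.
From mathcomp Require Import ring lra.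

(* Write y_k = x_0 x_k for the leaf spins seen from the hub x_0; the energy
   depends on y only, and orbit averaging randomizes x_0 given y.

   Upper bounds. A leaf with y_k = -1 always accepts a flip, and one with
   y_k = +1 accepts with probability at most e^(-beta); since the row sums of
   |K| are at most 1/2, the dynamics Q that only flips leaves contracts the
   largest single-flip increment of a function by 1 - 1/(18 d). For functions
   that are even under the antipode this bounds the oscillation of Q^t f, and
   log-convexity of t -> |Q^t f|^2 in L2 turns the decay into a spectral gap of
   order 1/d for Q, hence for P, whose Dirichlet form is larger. The two
   symmetrized kernels inherit a gap of order 1/d, and the least Gibbs mass is at
   least e^(-5 beta d), so they mix in time of order d * (beta d).

   Lower bound. The test function x_0 has mean 0 and variance 1, and its
   Dirichlet form is E[min(1, e^(-2 beta S))] / d with S the sum of the y_k.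
   Raising the field from beta/2 to beta one leaf at a time multiplies the
   partition function by at least cosh(beta/2) for each leaf, because the field
   beta/2 already present dominates the coupling. So the expectation is at most
   cosh(beta/2)^(-n) <= e^(- c_* beta n), and log-convexity bounds the decay of
   P^t x_0 from below. *)

Set Implicit Arguments.
Unset Strict Implicit.
Unset Printing Implicit Defensive.

Import Order.TTheory GRing.Theory Num.Theory.

Local Open Scope ring_scope.

(** * Kernels as operators on a weighted L2 space *)

(** Discriminant argument for the nonnegative quadratic t -> sum of w (a - t b)^2. *)
Lemma cauchy_schwarz_sum (R : realFieldType) (I : finType) (A : pred I)
    (w a b : I -> R) :
  (forall i, A i -> 0 <= w i) ->
  (\sum_(i | A i) w i * (a i * b i)) ^+ 2 <=
  (\sum_(i | A i) w i * a i ^+ 2) * (\sum_(i | A i) w i * b i ^+ 2).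
Proof.
move=> w_ge0.
set C := \sum_(i | A i) w i * (a i * b i).
set SA := \sum_(i | A i) w i * a i ^+ 2.
set SB := \sum_(i | A i) w i * b i ^+ 2.
have SB_ge0 : 0 <= SB.
  by apply: sumr_ge0 => i Ai; rewrite mulr_ge0 ?w_ge0 ?sqr_ge0.
have SA_ge0 : 0 <= SA.
  by apply: sumr_ge0 => i Ai; rewrite mulr_ge0 ?w_ge0 ?sqr_ge0.
have quad_ge0 t : 0 <= SA - 2 * t * C + t ^+ 2 * SB.
  have -> : SA - 2 * t * C + t ^+ 2 * SB =
            \sum_(i | A i) w i * (a i - t * b i) ^+ 2.
    rewrite /SA /SB /C !mulr_sumr -sumrB -big_split /=.
    by apply: eq_bigr => i _; ring.
  by apply: sumr_ge0 => i Ai; rewrite mulr_ge0 ?w_ge0 ?sqr_ge0.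
have [SB0|SB_neq0] := eqVneq SB 0.
  have [->|C_neq0] := eqVneq C 0; first by rewrite expr0n mulr_ge0.
  (* With [SB] zero the quadratic is affine in t, and this t gives it the value -1. *)
  have := quad_ge0 ((SA + 1) / (2 * C)); rewrite SB0 mulr0 addr0.
  have -> : 2 * ((SA + 1) / (2 * C)) * C = SA + 1 by field.
  lra.
have SB_gt0 : 0 < SB by rewrite lt_def SB_neq0.
have := quad_ge0 (C / SB).
have -> : SA - 2 * (C / SB) * C + (C / SB) ^+ 2 * SB = (SA * SB - C ^+ 2) / SB.
  by field.
by rewrite pmulr_lge0 ?invr_gt0 // subr_ge0.
Qed.

Lemma geometric_unbounded (R : realType) (q B : R) :
  1 < q -> exists t : nat, B < q ^+ t.
Proof.
move=> q_gt1; set h := q - 1; have h_gt0 : 0 < h by rewrite subr_gt0.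
have bernoulli t : 1 + t%:R * h <= q ^+ t.
  elim: t => [|t IH]; first by rewrite mul0r addr0 expr0.
  have t_ge0 : 0 <= t%:R :> R by [].
  rewrite exprS (_ : q = 1 + h); last by rewrite /h; ring.
  rewrite (_ : q = 1 + h) in IH; last by rewrite /h; ring.
  rewrite -natr1; apply: le_trans (ler_wpM2l _ IH); last lra.
  by have := mulr_ge0 t_ge0 (sqr_ge0 h); lra.
have [t Bt] : exists t : nat, B / h < t%:R.
  exists (Num.truncn `|B / h|).+1; apply: le_lt_trans (ler_norm _) _.
  exact: truncnS_gt.
exists t; apply: lt_le_trans (bernoulli t).
by move: Bt; rewrite ltr_pdivrMr //; lra.
Qed.

Section WeightedSpace.
Variables (R : realType) (X : finType) (mu : X -> R).
Hypothesis mu_ge0 : forall x, 0 <= mu x.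
Implicit Types f g h : X -> R.

Definition mean f : R := \sum_x mu x * f x.
Definition dot f g : R := \sum_x mu x * (f x * g x).
(** The square of the L2 norm; it may vanish at a nonzero f, since [mu] is only nonnegative. *)
Definition nrm f : R := dot f f.
Definition self_adjoint (A : (X -> R) -> X -> R) :=
  forall f g, dot (A f) g = dot f (A g).

Lemma dotC f g : dot f g = dot g f.
Proof. by apply: eq_bigr => x _; rewrite [f x * _]mulrC. Qed.

Lemma mean_dot f : mean f = dot f (fun=> 1).
Proof. by apply: eq_bigr => x _; rewrite mulr1. Qed.

Lemma nrm_ge0 f : 0 <= nrm f.
Proof. by apply: sumr_ge0 => x _; rewrite mulr_ge0 // -expr2 sqr_ge0. Qed.

Lemma cauchy_schwarz f g : dot f g ^+ 2 <= nrm f * nrm g.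
Proof.
have -> : nrm f = \sum_x mu x * f x ^+ 2 by apply: eq_bigr => x _; rewrite expr2.
have -> : nrm g = \sum_x mu x * g x ^+ 2 by apply: eq_bigr => x _; rewrite expr2.
exact: cauchy_schwarz_sum.
Qed.

Lemma nrm_eq0_self_adjoint A f : self_adjoint A -> nrm f = 0 -> nrm (A f) = 0.
Proof.
move=> saA f0; apply/eqP; rewrite -sqrf_eq0 eq_le sqr_ge0 andbT.
have := cauchy_schwarz f (A (A f)); rewrite f0 mul0r.
by rewrite /nrm saA.
Qed.

(* The ratios nrm (A^(t+1) f) / nrm (A^t f) are nondecreasing in t. *)
Lemma nrm_iter_ge A f c t : self_adjoint A -> 0 <= c ->
  c * nrm f <= nrm (A f) -> c ^+ t * nrm f <= nrm (iter t A f).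
Proof.
move=> saA c_ge0; elim: t f => [|t IH] f cf; first by rewrite expr0 mul1r.
rewrite iterSr; apply: le_trans (IH (A f) _); last first.
  have [f0|f_neq0] := eqVneq (nrm f) 0.
    by rewrite nrm_eq0_self_adjoint // mulr0 nrm_ge0.
  have f_gt0 : 0 < nrm f by rewrite lt_def f_neq0 nrm_ge0.
  have : nrm (A f) ^+ 2 <= nrm f * nrm (A (A f)).
    by rewrite {1}/nrm saA; exact: cauchy_schwarz.
  rewrite -(ler_pM2l f_gt0); apply: le_trans.
  by rewrite mulrA [nrm f * c]mulrC expr2 ler_wpM2r // nrm_ge0.
by rewrite exprSr -mulrA ler_wpM2l // exprn_ge0.
Qed.

(** If the first ratio c exceeded s, [nrm_iter_ge] would force growth at least c^t, which beats B
    s^t for large t. The prefactor B therefore disappears, so a crude decay estimate gives a sharp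
    one-step contraction. *)
Lemma nrm_le_decay A f s B : self_adjoint A -> 0 < s ->
  (forall t, nrm (iter t A f) <= B * s ^+ t) -> nrm (A f) <= s * nrm f.
Proof.
move=> saA s_gt0 decay.
have [f0|f_neq0] := eqVneq (nrm f) 0.
  by rewrite nrm_eq0_self_adjoint // f0 mulr0.
have f_gt0 : 0 < nrm f by rewrite lt_def f_neq0 nrm_ge0.
rewrite leNgt; apply/negP => sf.
set c := nrm (A f) / nrm f.
have c_gt : s < c by rewrite ltr_pdivlMr.
have [t] : exists t, B / nrm f < (c / s) ^+ t.
  by apply: geometric_unbounded; rewrite ltr_pdivlMr // mul1r.
rewrite ltr_pdivrMr // expr_div_n mulrAC ltr_pdivlMr ?exprn_gt0 //.
apply/negP; rewrite -leNgt; apply: le_trans (decay t).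
apply: nrm_iter_ge => //; first by rewrite ltW // (lt_trans s_gt0).
by rewrite divfK.
Qed.

Definition act (T : kernel R X) f : X -> R := fun x => \sum_y T x y * f y.

Lemma act_kmul S T f : act (kmul S T) f = act S (act T f).
Proof.
apply/funext => x; rewrite /act /kmul.
under eq_bigr do rewrite mulr_suml.
rewrite exchange_big /=; apply: eq_bigr => z _.
by rewrite mulr_sumr; apply: eq_bigr => y _; rewrite mulrA.
Qed.

Lemma act_kid f : act (kid R (X := X)) f = f.
Proof.
apply/funext => x; rewrite /act /kid (bigD1 x) //= eqxx mul1r big1 ?addr0 //.
by move=> y; rewrite eq_sym => /negbTE->; rewrite mul0r.
Qed.

Lemma act_kpow T t f : act (kpow T t) f = iter t (act T) f.
Proof.
elim: t => [|t IH]; first exact: act_kid.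
by rewrite /kpow !iterS act_kmul -IH.
Qed.

Lemma act_kmean S T f : act (kmean S T) f = fun x => (act S f x + act T f x) / 2.
Proof.
apply/funext => x; rewrite /act /kmean -big_split /= mulr_suml.
by apply: eq_bigr => y _; rewrite -mulrDl mulrAC.
Qed.

Lemma actB T f g x : act T (fun y => f y - g y) x = act T f x - act T g x.
Proof. by rewrite /act -sumrB; apply: eq_bigr => y _; rewrite mulrBr. Qed.

Hypothesis mu_sum1 : \sum_x mu x = 1.

Lemma mean_center f : mean (fun x => f x - mean f) = 0.
Proof.
rewrite {1}/mean; under eq_bigr do rewrite mulrBr.
by rewrite sumrB -mulr_suml mu_sum1 mul1r subrr.
Qed.

Lemma nrm_center_le f : nrm (fun x => f x - mean f) <= nrm f.
Proof.
have expand m : nrm (fun x => f x - m) =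
    nrm f - 2 * m * (\sum_x mu x * f x) + m ^+ 2 * \sum_x mu x.
  rewrite /nrm /dot !mulr_sumr -sumrB -big_split /=.
  by apply: eq_bigr => x _; ring.
rewrite expand -/(mean f) mu_sum1 mulr1.
have -> : nrm f - 2 * mean f * mean f + mean f ^+ 2 = nrm f - mean f ^+ 2.
  by ring.
by rewrite gerBl sqr_ge0.
Qed.

Lemma iter_act_center (T : kernel R X) f t c :
  (forall c, act T (fun=> c) = fun=> c) ->
  iter t (act T) (fun x => f x - c) = fun x => iter t (act T) f x - c.
Proof.
move=> T1; elim: t => //= t ->; apply/funext => x.
by rewrite actB T1.
Qed.

(** Duality: testing against the centred sign g of T^t(x, .) - mu writes the L1 distance D as (T^t
    g)(x). Keeping only the term at x in the squared norm gives p D^2 <= p / 4, hence D <= 1/2. *)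
Lemma dTV_le_contraction (T : kernel R X) rho p t x :
  (forall c, act T (fun=> c) = fun=> c) ->
  (forall f, mean (act T f) = mean f) ->
  0 <= rho -> (forall f, mean f = 0 -> nrm (act T f) <= rho * nrm f) ->
  0 < p -> p <= mu x -> rho ^+ t <= p / 4 ->
  dTV (kpow T t x) mu <= 1 / 4.
Proof.
move=> T1 Tmean rho_ge0 Trho p_gt0 p_le rho_t.
pose s y : R := Num.sg (kpow T t x y - mu y).
pose g y := s y - mean s.
have gt0 : forall i, mean (iter i (act T) g) = 0.
  by elim=> [|i IH] /=; rewrite ?Tmean // mean_center.
have Ng i : nrm (iter i (act T) g) <= rho ^+ i * nrm g.
  elim: i => [|i IH] /=; first by rewrite expr0 mul1r.
  apply: le_trans (Trho _ (gt0 i)) _.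
  by rewrite exprS -mulrA ler_wpM2l.
have Ng1 : nrm g <= 1.
  apply: le_trans (nrm_center_le s) _; rewrite /nrm /dot -mu_sum1.
  apply: ler_sum => y _; rewrite ler_piMr // -expr2 -real_normK ?num_real //.
  by rewrite exprn_ile1 // normr_sg; case: (_ != _).
have dE : \sum_y `|kpow T t x y - mu y| = iter t (act T) g x.
  rewrite iter_act_center // -act_kpow /act /mean -sumrB.
  apply: eq_bigr => y _; rewrite -mulrBl mulrC /s.
  by rewrite -normrEsg.
have : mu x * (iter t (act T) g x) ^+ 2 <= p / 4.
  apply: (le_trans _ rho_t); apply: (@le_trans _ _ (nrm (iter t (act T) g))).
    rewrite /nrm /dot (bigD1 x) //= expr2 lerDl.
    by apply: sumr_ge0 => y _; rewrite mulr_ge0 // -expr2 sqr_ge0.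
  by apply: le_trans (Ng t) _; rewrite ler_piMr // exprn_ge0.
rewrite /dTV dE; set D := iter _ _ _ _ => HD.
have {HD} : p * D ^+ 2 <= p * (1 / 4).
  rewrite mul1r; apply: le_trans HD; by rewrite ler_wpM2r // sqr_ge0.
rewrite ler_pM2l // => D2.
have : D <= 1 / 2.
  rewrite leNgt; apply/negP => D_gt.
  have : (1 / 2) * (1 / 2) < D * D by apply: ltr_pM => //; lra.
  by rewrite -expr2; lra.
lra.
Qed.

Lemma worst_dTV_le_contraction (T : kernel R X) rho p t :
  (forall c, act T (fun=> c) = fun=> c) ->
  (forall f, mean (act T f) = mean f) ->
  0 <= rho -> (forall f, mean f = 0 -> nrm (act T f) <= rho * nrm f) ->
  0 < p -> (forall x, p <= mu x) -> rho ^+ t <= p / 4 ->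
  worst_dTV T mu t <= 1 / 4.
Proof.
move=> T1 Tmean rho_ge0 Trho p_gt0 p_le rho_t; apply/bigmax_leP; split=> [|x _].
  lra.
exact: dTV_le_contraction (p_le x) rho_t.
Qed.

(** Used for the lower bound: a slowly decaying observable certifies distance from stationarity. *)
Lemma act_kpow_le_dTV (T : kernel R X) f t x :
  mean f = 0 -> (forall y, `|f y| <= 1) ->
  `|iter t (act T) f x| <= 2 * worst_dTV T mu t.
Proof.
move=> f0 f1; apply: (@le_trans _ _ (2 * dTV (kpow T t x) mu)); last first.
  by rewrite ler_pM2l // /worst_dTV le_bigmax_cond.
rewrite -act_kpow -[act _ _ _]subr0 -f0 /act /mean -sumrB.
rewrite /dTV mulrA divff ?pnatr_eq0 // mul1r.
apply: le_trans (ler_norm_sum _ _ _) _; apply: ler_sum => y _.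
by rewrite -mulrBl normrM ler_piMr.
Qed.

End WeightedSpace.

Lemma exists_mixing_time (R : realType) (X : finType) (T : kernel R X)
    (mu : X -> R) eps s :
  worst_dTV T mu s <= eps -> exists2 t, is_mixing_time T mu eps t & (t <= s)%N.
Proof.
move=> s_ok; have ex : exists t, worst_dTV T mu t <= eps by exists s.
exists (ex_minn ex); case: ex_minnP => t t_ok t_min; first by split.
exact: t_min.
Qed.

(** * Reversible chains moving by involutions *)

Section InvolutionChain.
Variables (R : realType) (X I : finType) (mu : X -> R).
Variables (sigma : I -> X -> X) (c : I -> X -> R).
Hypothesis mu_ge0 : forall x, 0 <= mu x.
Hypothesis sigmaK : forall i, involutive (sigma i).
Hypothesis c_ge0 : forall i x, 0 <= c i x.
Hypothesis c_balance :
  forall i x, mu x * c i x = mu (sigma i x) * c i (sigma i x).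
Hypothesis c_sum : forall x, \sum_i c i x <= 1 / 2.
Implicit Types (A : pred I) (f g : X -> R).

(** The predicate [A] selects the moves that are kept, so that the full chain and the chain with a
    frozen hub are instances of one operator. *)
Definition step A f : X -> R :=
  fun x => f x + \sum_(i | A i) c i x * (f (sigma i x) - f x).

(** Twice the usual Dirichlet form, whence the division by 2 in [dot_step]. *)
Definition dirichlet A f g : R :=
  \sum_(i | A i) \sum_x
    mu x * (c i x * ((f (sigma i x) - f x) * (g (sigma i x) - g x))).

Lemma dot_step A f g : dot mu (step A f) g = dot mu f g - dirichlet A f g / 2.
Proof.
have half i : \sum_x mu x * (c i x * (f (sigma i x) - f x) * g x) =
    - (\sum_x mu x * (c i x * ((f (sigma i x) - f x) *
                                (g (sigma i x) - g x)))) / 2.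
  set S := LHS.
  have SE : S = \sum_x mu x * (c i x * (f x - f (sigma i x)) * g (sigma i x)).
    rewrite /S (reindex_inj (inv_inj (sigmaK i))) /=.
    by apply: eq_bigr => x _; rewrite sigmaK !mulrA -c_balance.
  have : S + S = - (\sum_x mu x * (c i x * ((f (sigma i x) - f x) *
                                (g (sigma i x) - g x)))).
    rewrite {2}SE /S -sumrN -big_split /=.
    by apply: eq_bigr => x _; ring.
  by move=> <-; field.
rewrite /dirichlet mulr_suml -sumrN /dot.
under [X in _ = _ + X]eq_bigr do rewrite -mulNr -half.
rewrite exchange_big /= -big_split /=; apply: eq_bigr => x _.
by rewrite -mulr_sumr -mulr_suml -mulrDr -mulrDl.
Qed.

Lemma dirichletC A f g : dirichlet A f g = dirichlet A g f.
Proof.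
apply: eq_bigr => i _; apply: eq_bigr => x _.
by rewrite [(f _ - _) * _]mulrC.
Qed.

Lemma dirichlet_ge0 A f : 0 <= dirichlet A f f.
Proof.
apply: sumr_ge0 => i _; apply: sumr_ge0 => x _.
by rewrite mulr_ge0 // mulr_ge0 // -expr2 sqr_ge0.
Qed.

Lemma step_self_adjoint A : self_adjoint mu (step A).
Proof. by move=> f g; rewrite [RHS]dotC !dot_step dotC dirichletC. Qed.

Lemma step_cst A a : step A (fun=> a) = fun=> a.
Proof.
apply/funext => x; rewrite /step big1 ?addr0 // => i _.
by rewrite subrr mulr0.
Qed.

Lemma mean_step A f : mean mu (step A f) = mean mu f.
Proof. by rewrite !mean_dot step_self_adjoint step_cst. Qed.

(** Every move adds a nonnegative term to the Dirichlet form; this transfers a gap from the leaf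
    dynamics to the full one. *)
Lemma dot_step_subset A (B : pred I) f : (forall i, A i -> B i) ->
  dot mu (step B f) f <= dot mu (step A f) f.
Proof.
move=> AB; rewrite !dot_step lerD2l lerN2 ler_pM2r ?invr_gt0 //.
rewrite /dirichlet [leRHS](bigID A) /=.
rewrite [X in _ <= X + _](eq_bigl A) => [|i]; last first.
  by rewrite andbC; case: (boolP (A i)) => // /AB ->.
rewrite lerDl; apply: sumr_ge0 => i _; apply: sumr_ge0 => x _.
by rewrite mulr_ge0 // mulr_ge0 // -expr2 sqr_ge0.
Qed.

(* Laziness makes the increment u of a step satisfy nrm u <= dirichlet f f / 2,
   so that step A is positive semidefinite. *)
Lemma nrm_step_le A f : nrm mu (step A f) <= dot mu (step A f) f.
Proof.
pose u x := \sum_(i | A i) c i x * (f (sigma i x) - f x).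
have fu : dot mu (step A f) f = nrm mu f + dot mu u f.
  by rewrite /nrm /dot -big_split /=; apply: eq_bigr => x _;
     rewrite /step -/(u x); ring.
have -> : nrm mu (step A f) = nrm mu f + 2 * dot mu u f + nrm mu u.
  rewrite /nrm /dot mulr_sumr -!big_split /=; apply: eq_bigr => x _.
  by rewrite /step -/(u x); ring.
have uE : dot mu u f = - (dirichlet A f f / 2).
  by move: fu; rewrite dot_step /nrm; lra.
rewrite fu; suff : nrm mu u <= dirichlet A f f / 2 by rewrite uE; lra.
rewrite /dirichlet exchange_big /= mulr_suml; apply: ler_sum => x _.
rewrite -mulr_sumr -mulrA ler_wpM2l // -expr2.
(* Cauchy-Schwarz against the constant 1, with the rates at x as weights; their total is at most
   1/2. *)
have := @cauchy_schwarz_sum R I A (c ^~ x) (fun i => f (sigma i x) - f x)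
          (fun=> 1) (fun i _ => c_ge0 i x).
rewrite /u; under eq_bigr do rewrite mulr1.
move=> /le_trans; apply.
under [X in X * _]eq_bigr do rewrite expr2.
apply: ler_wpM2l.
  by apply: sumr_ge0 => i _; rewrite mulr_ge0 // -expr2 sqr_ge0.
under eq_bigr do rewrite expr1n mulr1.
have := c_sum x; rewrite mul1r; apply: le_trans.
by rewrite [leRHS](bigID A) /= lerDl sumr_ge0.
Qed.

Lemma nrm_step_mono A f : nrm mu (step A f) <= nrm mu f.
Proof.
apply: le_trans (nrm_step_le A f) _.
by rewrite dot_step gerBl divr_ge0 // dirichlet_ge0.
Qed.

Hypothesis sigmaC : forall i j x, sigma i (sigma j x) = sigma j (sigma i x).

Lemma lipschitz_step A f k x L gamma delta :
  A k -> (forall i y, A i -> `|f (sigma i y) - f y| <= L) ->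
  gamma <= c k x + c k (sigma k x) ->
  \sum_(i | A i && (i != k)) `|c i (sigma k x) - c i x| <= delta ->
  `|step A f (sigma k x) - step A f x| <= (1 - gamma + delta) * L.
Proof.
move=> Ak fL gamma_le delta_ge; set x' := sigma k x; set D := f x' - f x.
have L_ge0 : 0 <= L by apply: le_trans (fL k x Ak).
set B := fun i => A i && (i != k).
set S := \sum_(i | B i) c i x.
(* The first coefficient is nonnegative by laziness, so the three bounds add up and S cancels. *)
have -> : step A f x' - step A f x =
    D * (1 - c k x - c k x' - S) +
    \sum_(i | B i) c i x * (f (sigma i x') - f (sigma i x)) +
    \sum_(i | B i) (c i x' - c i x) * (f (sigma i x') - f x').
  rewrite /step (bigD1 k) //= [in X in _ - X](bigD1 k) //= -/x'.
  rewrite [sigma k x']sigmaK -/D.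
  have -> : \sum_(i | A i && (i != k)) c i x' * (f (sigma i x') - f x') =
      \sum_(i | B i) c i x * (f (sigma i x) - f x) - D * S +
      \sum_(i | B i) c i x * (f (sigma i x') - f (sigma i x)) +
      \sum_(i | B i) (c i x' - c i x) * (f (sigma i x') - f x').
    rewrite /S mulr_sumr -sumrN -!big_split /=; apply: eq_bigr => i _.
    by rewrite /D; ring.
  by rewrite -/B /D; ring.
have S_ge0 : 0 <= S by apply: sumr_ge0.
have ck_le y : c k y <= 1 / 2.
  by apply: le_trans (c_sum y); rewrite (bigD1 k) //= lerDl sumr_ge0.
have ckS : c k x + S <= 1 / 2.
  apply: le_trans (c_sum x); rewrite [leRHS](bigID A) /= (bigD1 k) //=.
  by rewrite -/S -[leLHS]addr0 lerD // sumr_ge0.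
have ckx' := ck_le x'.
apply: le_trans (ler_normD _ _) _.
apply: le_trans (lerD (ler_normD _ _) (lexx _)) _.
have b1 : `|D * (1 - c k x - c k x' - S)| <= (1 - c k x - c k x' - S) * L.
  rewrite normrM mulrC [X in X * _]ger0_norm; last by lra.
  by apply: ler_wpM2l; [lra | exact: fL].
have b2 : `|\sum_(i | B i) c i x * (f (sigma i x') - f (sigma i x))| <= S * L.
  apply: le_trans (ler_norm_sum _ _ _) _; rewrite /S mulr_suml.
  apply: ler_sum => i _; rewrite normrM [X in X * _]ger0_norm //.
  by rewrite ler_wpM2l // sigmaC fL.
have b3 : `|\sum_(i | B i) (c i x' - c i x) * (f (sigma i x') - f x')| <=
    delta * L.
  apply: le_trans (ler_norm_sum _ _ _) _; apply: le_trans (ler_wpM2r L_ge0 delta_ge).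
  rewrite mulr_suml; apply: ler_sum => i /andP[Ai _].
  by rewrite normrM ler_wpM2l // fL.
have := ler_wpM2r L_ge0 gamma_le; rewrite -/x'.
lra.
Qed.

End InvolutionChain.

(** * Spin flips and energies *)

(** A mean-zero f is at each point the average of its differences to the other values. *)
Lemma nrm_le_osc (R : realType) (X : finType) (mu : X -> R) (f : X -> R) M :
  (forall x, 0 <= mu x) -> \sum_x mu x = 1 -> mean mu f = 0 ->
  (forall x y, `|f x - f y| <= M) -> nrm mu f <= M ^+ 2.
Proof.
move=> mu_ge0 mu1 f0 osc; rewrite -[M ^+ 2]mul1r -mu1 mulr_suml.
apply: ler_sum => x _; rewrite ler_wpM2l // -expr2 -[_ ^+ 2]real_normK ?num_real //.
have M_ge0 : 0 <= M by apply: le_trans (osc x x).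
rewrite ler_sqr ?nnegrE //.
have -> : f x = \sum_y mu y * (f x - f y).
  under eq_bigr do rewrite mulrBr.
  by rewrite sumrB -mulr_suml mu1 -/(mean mu f) f0 mul1r subr0.
apply: le_trans (ler_norm_sum _ _ _) _.
rewrite -[M]mul1r -mu1 mulr_suml; apply: ler_sum => y _.
by rewrite normrM ger0_norm // ler_wpM2l.
Qed.

(** The slope of s -> e^(-b s) on [1, oo) is largest in absolute value at s = 1. *)
Lemma expR_lipschitz (R : realType) (b s t : R) : 0 <= b -> 1 <= s -> 1 <= t ->
  `|expR (- b * s) - expR (- b * t)| <= b * expR (- b) * `|s - t|.
Proof.
move=> b_ge0; wlog st : s t / s <= t => [main s1 t1|s1 t1].
  have /orP[st|ts] := le_total s t; first exact: main.
  by rewrite distrC [X in _ <= _ * X]distrC main.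
rewrite ger0_norm; last by rewrite subr_ge0 ler_expR !mulNr lerN2 ler_wpM2l.
rewrite distrC ger0_norm ?subr_ge0 //.
have -> : expR (- b * t) = expR (- b * s) * expR (- b * (t - s)).
  by rewrite -expRD; congr expR; ring.
rewrite -[X in X - _]mulr1 -mulrBr [b * _]mulrC -mulrA.
apply: ler_pM; rewrite ?expR_ge0 //.
- by rewrite subr_ge0 expR_le1 mulNr oppr_le0 mulr_ge0 // subr_ge0.
- by rewrite ler_expR mulNr lerN2 ler_peMr.
- by have := expR_ge1Dx (- b * (t - s)); lra.
Qed.

(** The true maximum is 1/e, and e >= (3/2)^2. A constant below 1/2 is what leaves room for
    contraction in [leaf_dynamics_contracts]. *)
Lemma mul_expRN_le (R : realType) (b : R) : b * expR (- b) <= 4 / 9.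
Proof.
have e_ge : (9 / 4 : R) <= expR 1.
  rewrite [X in expR X](_ : 1 = 1 / 2 + 1 / 2); last by field.
  rewrite expRD; have half := expR_ge1Dx (1 / 2 : R).
  rewrite [leLHS](_ : _ = (1 + 1 / 2) * (1 + 1 / 2)); last by field.
  by apply: ler_pM => //; lra.
have b_le : b <= expR b / expR 1.
  by rewrite -expRB; have := expR_ge1Dx (b - 1); lra.
rewrite expRN ler_pdivrMr ?expR_gt0 //; apply: le_trans b_le _.
rewrite ler_pdivrMr ?expR_gt0 // mulrAC -[leLHS]mul1r ler_wpM2r ?expR_ge0 //.
by rewrite mulrC; lra.
Qed.

Section SpinFlips.
Variables (R : realType) (n : nat).
Implicit Types (x y : config n) (i j : 'I_n.+1) (f : config n -> R).

Lemma flipE x i j : flip x i j = if j == i then ~~ x j else x j.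
Proof. by rewrite ffunE. Qed.

Lemma antipodeE x j : antipode x j = ~~ x j.
Proof. by rewrite ffunE. Qed.

Lemma flipK i : involutive (fun x => flip x i).
Proof. by move=> x; apply/ffunP => j; rewrite !flipE; case: eqP => //;
rewrite negbK.
Qed.

Lemma flipC x i j : flip (flip x i) j = flip (flip x j) i.
Proof.
by apply/ffunP => k; rewrite !flipE; case: (k == i); case: (k == j).
Qed.

Lemma flip_injr x : injective (flip x).
Proof.
move=> i j /ffunP /(_ i); rewrite !flipE eqxx; case: eqP => // _.
by case: (x i).
Qed.

Lemma flip_neq x i : flip x i != x.
Proof. by apply/eqP => /ffunP /(_ i); rewrite flipE eqxx; case: (x i). Qed.

Lemma antipodeK : involutive (@antipode n).
Proof. by move=> x; apply/ffunP => j; rewrite !antipodeE negbK. Qed.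

Lemma antipode_flip x i : antipode (flip x i) = flip (antipode x) i.
Proof. by apply/ffunP => j; rewrite antipodeE !flipE antipodeE; case: ifP. Qed.

Lemma spin_flip x i j :
  spin R (flip x i) j = if j == i then - spin R x j else spin R x j.
Proof. by rewrite /spin flipE; case: eqP => // _; case: (x j); rewrite //= opprK. Qed.

Lemma spin_antipode x j : spin R (antipode x) j = - spin R x j.
Proof. by rewrite /spin antipodeE; case: (x j); rewrite //= opprK. Qed.

Lemma spin_pm x i : spin R x i = 1 \/ spin R x i = -1.
Proof. by rewrite /spin; case: (x i); [left | right]. Qed.

Lemma normr_spin x i : `|spin R x i| = 1.
Proof. by case: (spin_pm x i) => ->; rewrite ?normrN normr1. Qed.

(** Walk from x to y, flipping the sites of s where they disagree one at a time. *)
Lemma osc_le_path (s : seq 'I_n.+1) f L x y :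
  (forall i z, i \in s -> `|f (flip z i) - f z| <= L) ->
  (forall i, i \notin s -> x i = y i) ->
  `|f x - f y| <= (size s)%:R * L.
Proof.
elim: s x => [|a s IH] x fL xy.
  suff -> : x = y by rewrite subrr normr0 mul0r.
  by apply/ffunP => i; apply: xy.
have L_ge0 : 0 <= L by apply: le_trans (fL a x (mem_head _ _)).
have fL' i z : i \in s -> `|f (flip z i) - f z| <= L.
  by move=> si; apply: fL; rewrite inE si orbT.
rewrite [size _]/= -natr1 mulrDl mul1r.
have [xya|xya] := eqVneq (x a) (y a).
  apply: le_trans (IH x fL' _) _; last by rewrite lerDl.
  move=> i si; have [->//|ia] := eqVneq i a.
  by apply: xy; rewrite inE negb_or ia.
rewrite [leRHS]addrC; apply: le_trans (ler_distD (f (flip x a)) _ _) _.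
rewrite lerD //; first by rewrite distrC fL ?mem_head.
apply: IH => // i si; rewrite flipE; have [->|ia] := eqVneq i a.
  by move: xya; case: (x a) => /=; case: (y a).
by apply: xy; rewrite inE negb_or ia.
Qed.

Lemma act_antipode_kernel f : act (antipode_kernel R n) f = f \o @antipode n.
Proof.
apply/funext => x; rewrite /act /antipode_kernel (bigD1 (antipode x)) //= eqxx mul1r.
by rewrite big1 ?addr0 // => y /negbTE ->; rewrite mul0r.
Qed.

Lemma act_orbit_average f :
  act (orbit_average R n) f = fun x => (f x + f (antipode x)) / 2.
Proof.
by rewrite /orbit_average act_kmean act_kid act_antipode_kernel.
Qed.

End SpinFlips.

(** * Metropolis rates and energy increments of single flips *)

Section Model.
Variables (R : realType) (n : nat) (K : 'M[R]_n) (beta : R).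
Implicit Types (x y : config n) (i j : 'I_n.+1) (f : config n -> R).

Local Notation H := (hamiltonian K).
Local Notation pi := (gibbs K beta).

Definition flip_rate i x : R := metropolis_rate K beta x (flip x i).

Local Notation stepf := (step (fun i x => flip x i) flip_rate).

Lemma act_metropolis f : act (metropolis K beta) f = stepf predT f.
Proof.
apply/funext => x; rewrite /act (bigD1 x) //= /metropolis eqxx.
have -> : \sum_(y | y != x)
    (if y == x then 1 - \sum_(i < n.+1) metropolis_rate K beta x (flip x i)
     else if [exists i, y == flip x i] then metropolis_rate K beta x y else 0) * f y =
    \sum_i flip_rate i x * f (flip x i).
  transitivity (\sum_(y in [set flip x i | i in 'I_n.+1])
      metropolis_rate K beta x y * f y); last first.
    by rewrite big_imset //= => i j _ _; apply: flip_injr.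
  rewrite big_mkcond [RHS]big_mkcond; apply: eq_bigr => y _.
  have <- : [exists i, y == flip x i] = (y \in [set flip x i | i in 'I_n.+1]).
    apply/existsP/imsetP => [[i /eqP ->]|[i _ ->]]; first by exists i.
    by exists i.
  have [->|yx] /= := eqVneq y x; last first.
    by case: existsP => //; rewrite mul0r.
  by case: existsP => // -[i]; rewrite eq_sym (negbTE (flip_neq x i)).
rewrite /step mulrBl mul1r -addrA; congr (_ + _).
rewrite mulr_suml addrC -sumrB; apply: eq_bigr => i _.
by rewrite mulrBr.
Qed.

Lemma partition_gt0 : 0 < partition_function K beta.
Proof.
rewrite /partition_function (bigD1 [ffun=> true]) //=.
by rewrite ltr_wpDr ?expR_gt0 // sumr_ge0 // => x _; apply: expR_ge0.
Qed.

Lemma gibbs_gt0 x : 0 < pi x.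
Proof. by rewrite divr_gt0 ?expR_gt0 // partition_gt0. Qed.

Lemma gibbs_ge0 x : 0 <= pi x.
Proof. exact: ltW (gibbs_gt0 x). Qed.

Lemma gibbs_sum1 : \sum_x pi x = 1.
Proof. by rewrite -mulr_suml divff // gt_eqF // partition_gt0. Qed.

(** The right side is symmetric in the two configurations, which is detailed balance; it also bounds
    the edge flows from below. *)
Lemma gibbs_flip_rate i x :
  pi x * flip_rate i x = (2 * n.+1%:R)^-1 * Num.min (pi x) (pi (flip x i)).
Proof.
rewrite /flip_rate /metropolis_rate mulrCA; congr (_ * _).
rewrite minr_pMr ?gibbs_ge0 // mulr1; congr Num.min.
rewrite /gibbs mulrAC -expRD; congr (expR _ / _); ring.
Qed.

Lemma flip_rate_balance i x :
  pi x * flip_rate i x = pi (flip x i) * flip_rate i (flip x i).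
Proof. by rewrite !gibbs_flip_rate flipK minC. Qed.

Lemma flip_rate_ge0 i x : 0 <= flip_rate i x.
Proof.
by rewrite mulr_ge0 ?invr_ge0 ?mulr_ge0 // le_min ler01 expR_ge0.
Qed.

Lemma flip_rate_le i x : flip_rate i x <= (2 * n.+1%:R)^-1.
Proof.
by rewrite ler_piMr ?invr_ge0 ?mulr_ge0 // ge_min lexx.
Qed.

Lemma flip_rate_sum x : \sum_i flip_rate i x <= 1 / 2.
Proof.
apply: (@le_trans _ _ (\sum_(i < n.+1) (2 * n.+1%:R)^-1)).
  by apply: ler_sum => i _; apply: flip_rate_le.
rewrite sumr_const card_ord -(mulr_natl (_^-1)).
have : n.+1%:R != 0 :> R by rewrite pnatr_eq0.
by move: (n.+1%:R : R) => d d_neq0; rewrite le_eqVlt; apply/orP; left; apply/eqP; field.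
Qed.


Lemma hamiltonian_antipode x : H (antipode x) = H x.
Proof.
rewrite /hamiltonian spin_antipode; congr (_ - _).
  rewrite opprK; under eq_bigr do rewrite spin_antipode.
  by rewrite sumrN mulrN mulNr.
apply: eq_bigr => i _; apply: eq_bigr => j _.
by rewrite !spin_antipode; ring.
Qed.

Lemma gibbs_antipode x : pi (antipode x) = pi x.
Proof. by rewrite /gibbs hamiltonian_antipode. Qed.

Lemma flip_rate_antipode i x : flip_rate i (antipode x) = flip_rate i x.
Proof.
by rewrite /flip_rate /metropolis_rate -antipode_flip !hamiltonian_antipode.
Qed.

Lemma step_antipode (A : pred 'I_n.+1) f x :
  stepf A f (antipode x) = stepf A (f \o @antipode n) x.
Proof.
rewrite /step; congr (_ + _); apply: eq_bigr => i _.
by rewrite flip_rate_antipode /= antipode_flip.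
Qed.

Hypothesis K_sym : K^T = K.
Hypothesis K_diag : forall i : 'I_n, K i i = 0.
Hypothesis K_row : forall i : 'I_n, \sum_j `|K i j| <= 1 / 2.
Implicit Types k : 'I_n.

Local Notation s x k := (spin R x (lift ord0 k)).

(** The local field that the other leaves exert on leaf k. *)
Definition coupling x k : R := \sum_j K k j * s x j.

Definition interaction x : R :=
  \sum_(i < n) \sum_(j < n | (i < j)%N) K i j * s x i * s x j.

Lemma interactionE x : interaction x = (\sum_k s x k * coupling x k) / 2.
Proof.
have KC (i j : 'I_n) : K i j = K j i by rewrite -[in LHS]K_sym mxE.
pose a (i j : 'I_n) : R := K i j * s x i * s x j.
have aC (i j : 'I_n) : a i j = a j i by rewrite /a KC -!mulrA [s x i * _]mulrC.
have -> : \sum_k s x k * coupling x k = \sum_i \sum_j a i j.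
  apply: eq_bigr => i _; rewrite /coupling mulr_sumr.
  by apply: eq_bigr => j _; rewrite /a; ring.
have E : \sum_i \sum_j a i j =
    \sum_(i < n) \sum_(j < n | (i < j)%N) a i j +
    \sum_(i < n) \sum_(j < n | (j < i)%N) a i j.
  rewrite -big_split; apply: eq_bigr => i _ /=.
  rewrite (bigID (fun j : 'I_n => (i < j)%N)) /=; congr (_ + _).
  rewrite [LHS]big_mkcond [RHS]big_mkcond; apply: eq_bigr => j _.
  case: (ltngtP i j) => //= ij.
  by rewrite /a (_ : j = i) ?K_diag ?mul0r //; apply/val_inj.
have F : \sum_(i < n) \sum_(j < n | (j < i)%N) a i j = interaction x.
  rewrite (exchange_big_dep predT) //=; apply: eq_bigr => i _.
  by apply: eq_bigr => j _; rewrite aC.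
by rewrite E F -/(interaction x); field.
Qed.

Lemma spin_flip_site x k (j : 'I_n) :
  s (flip x (lift ord0 k)) j = s x j + (j == k)%:R * (- 2 * s x k).
Proof.
rewrite spin_flip (inj_eq lift_inj); case: eqP => [->|_]; last by rewrite mul0r addr0.
by rewrite mul1r; ring.
Qed.

Lemma sum_delta (F : 'I_n -> R) k (t : R) : \sum_j F j * ((j == k)%:R * t) = F k * t.
Proof.
rewrite (bigD1 k) //= eqxx mul1r big1 ?addr0 // => j /negbTE ->.
by rewrite mul0r mulr0.
Qed.

Lemma coupling_flip x k (j : 'I_n) :
  coupling (flip x (lift ord0 k)) j = coupling x j - 2 * K j k * s x k.
Proof.
rewrite /coupling; under eq_bigr do rewrite spin_flip_site mulrDr.
by rewrite big_split /= sum_delta; ring.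
Qed.

Lemma interaction_flip0 x : interaction (flip x ord0) = interaction x.
Proof.
by apply: eq_bigr => i _; apply: eq_bigr => j _; rewrite !spin_flip.
Qed.

Lemma interaction_flip x k :
  interaction (flip x (lift ord0 k)) = interaction x - 2 * s x k * coupling x k.
Proof.
rewrite !interactionE.
under eq_bigr do rewrite coupling_flip spin_flip_site mulrDl.
rewrite big_split /=.
under eq_bigr do rewrite mulrBr.
under [X in _ + X]eq_bigr => i _ do rewrite mulrC.
rewrite sum_delta K_diag sumrB.
(* By symmetry of K, the fields at the other leaves change by as much in total as the own term of
   leaf k, which compensates the factor 1/2. *)
have -> : \sum_i s x i * (2 * K i k * s x k) = 2 * s x k * coupling x k.
  rewrite /coupling mulr_sumr; apply: eq_bigr => i _.
  by rewrite -[in LHS]K_sym mxE; ring.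
by field.
Qed.

Lemma hamiltonianE x : H x = - (spin R x ord0 * \sum_k s x k) - interaction x.
Proof. by rewrite /hamiltonian mulNr. Qed.

Lemma hamiltonian_flip x k :
  H (flip x (lift ord0 k)) - H x = 2 * s x k * (spin R x ord0 + coupling x k).
Proof.
rewrite !hamiltonianE interaction_flip.
under eq_bigr do rewrite spin_flip_site -[X in _ + X]mul1r.
by rewrite big_split /= sum_delta spin_flip /=; ring.
Qed.

Lemma hamiltonian_flip0 x :
  H (flip x ord0) - H x = 2 * (spin R x ord0 * \sum_k s x k).
Proof.
rewrite !hamiltonianE interaction_flip0 spin_flip eqxx.
under eq_bigr do rewrite spin_flip /=.
by ring.
Qed.

Lemma norm_coupling_le x k : `|coupling x k| <= 1 / 2.
Proof.
apply: le_trans (ler_norm_sum _ _ _) _; apply: le_trans _ (K_row k).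
by apply: ler_sum => j _; rewrite normrM normr_spin mulr1.
Qed.

End Model.

(** * Spectral gap of the symmetrized kernels *)

Section UpperBound.
Variables (R : realType) (n : nat) (K : 'M[R]_n) (beta : R).
Hypothesis K_sym : K^T = K.
Hypothesis K_diag : forall i : 'I_n, K i i = 0.
Hypothesis K_row : forall i : 'I_n, \sum_j `|K i j| <= 1 / 2.
Hypothesis beta_ge1 : 1 <= beta.
Implicit Types (x y z : config n) (k : 'I_n) (f : config n -> R).

Local Notation H := (hamiltonian K).
Local Notation pi := (gibbs K beta).
Local Notation d := (n.+1%:R : R).
Local Notation rate := (flip_rate K beta).
Local Notation P := (step (fun i x => flip x i) rate predT).
(* The single-site dynamics with the spin at the hub frozen. *)
Local Notation Q := (step (fun i x => flip x i) rate (predC1 ord0)).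
Local Notation s x k := (spin R x (lift ord0 k)).
Local Notation s0 x := (spin R x ord0).

Lemma flip_rateE x k :
  rate (lift ord0 k) x = (2 * d)^-1 *
    Num.min 1 (expR (- beta * (2 * s x k * (s0 x + coupling K x k)))).
Proof. by rewrite /flip_rate /metropolis_rate hamiltonian_flip. Qed.

(** The hub acts with strength 1 and the coupling with at most 1/2, so aligning a leaf with the hub
    lowers the energy. *)
Lemma flip_rate_up x k : s x k = - s0 x -> rate (lift ord0 k) x = (2 * d)^-1.
Proof.
move=> xk; rewrite flip_rateE xk.
have := norm_coupling_le K_row x k; rewrite ler_norml => /andP[ul uu].
rewrite min_l ?mulr1 // -[leLHS]expR0 ler_expR mulNr -mulrN.
rewrite mulr_ge0 ?(le_trans ler01) //.
by case: (spin_pm R x ord0) => ->; lra.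
Qed.

Lemma flip_rate_down x k : s x k = s0 x ->
  1 <= 2 * s x k * (s0 x + coupling K x k) /\
  rate (lift ord0 k) x =
    (2 * d)^-1 * expR (- beta * (2 * s x k * (s0 x + coupling K x k))).
Proof.
move=> xk.
have : 1 <= 2 * s x k * (s0 x + coupling K x k).
  rewrite xk; have := norm_coupling_le K_row x k; rewrite ler_norml => /andP[ul uu].
  by case: (spin_pm R x ord0) => ->; lra.
move=> D_ge1; split=> //; rewrite flip_rateE min_r // expR_le1 mulNr oppr_le0.
by rewrite mulr_ge0 ?(le_trans ler01) // (le_trans ler01).
Qed.

(** Flipping j changes neither leaf k nor the hub. A disagreeing leaf k has constant rate; for an
    agreeing one the energy cost stays at least 1 and moves by 4 |K k j|, and 4/9 bounds the
    slope. *)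
Lemma flip_rate_lipschitz x k (j : 'I_n) : k != j ->
  `|rate (lift ord0 k) (flip x (lift ord0 j)) - rate (lift ord0 k) x| <=
  (2 * d)^-1 * (4 / 9 * (4 * `|K k j|)).
Proof.
move=> kj; set x' := flip x _.
have sk : s x' k = s x k by rewrite spin_flip (inj_eq lift_inj) (negbTE kj).
have s0E : s0 x' = s0 x by rewrite spin_flip.
have pos : 0 <= (2 * d)^-1 by rewrite invr_ge0 mulr_ge0.
have [xk|xk] : s x k = - s0 x \/ s x k = s0 x.
- by case: (spin_pm R x ord0) => ->; case: (spin_pm R x (lift ord0 k)) => ->;
     rewrite ?opprK; auto.
- rewrite !flip_rate_up ?sk ?s0E // subrr normr0.
  by rewrite !mulr_ge0 // ?invr_ge0.
have [D1 ->] := flip_rate_down xk.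
have xk' : s x' k = s0 x' by rewrite sk s0E.
have [D2 ->] := flip_rate_down xk'.
rewrite -mulrBr normrM ger0_norm // ler_wpM2l //.
have beta_ge0 : 0 <= beta by exact: le_trans ler01 beta_ge1.
apply: le_trans (expR_lipschitz beta_ge0 D2 D1) _.
apply: ler_pM; rewrite ?mul_expRN_le //; first by rewrite mulr_ge0 ?expR_ge0.
rewrite sk s0E coupling_flip.
have -> : 2 * s x k * (s0 x + (coupling K x k - 2 * K k j * s x j)) -
    2 * s x k * (s0 x + coupling K x k) = - (4 * (s x k * (K k j * s x j))) by ring.
by rewrite normrN !normrM !normr_spin mul1r mulr1 ger0_norm.
Qed.

Definition lip_on_leaves f (L : R) :=
  forall i z, i != ord0 -> `|f (flip z i) - f z| <= L.

Local Notation r := (1 - (18 * d)^-1).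

Lemma d_gt0 : 0 < d. Proof. by []. Qed.

Lemma contraction_rate_gt0 : 0 < r.
Proof.
have d1 : 1 <= d by rewrite ler1n.
have : (18 * d)^-1 <= 18^-1 by rewrite lef_pV2 ?posrE //; lra.
by move: (_^-1) => u; lra.
Qed.

Lemma leaf_dynamics_contracts f L :
  lip_on_leaves f L -> lip_on_leaves (Q f) (r * L).
Proof.
move=> fL i x; case: (unliftP ord0 i) => [k ->|->]; last by rewrite eqxx.
move=> k0.
(* The flip of leaf k gains 1/(2d); the other rates give back at most 4/9 * 4 * 1/2 = 8/9 of it. *)
have rE : r = 1 - (2 * d)^-1 + (2 * d)^-1 * (8 / 9).
  have := d_gt0; move: d => e e_gt0; field.
  by rewrite gt_eqF.
rewrite rE; apply: lipschitz_step => //.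
- exact: flipK.
- exact: flip_rate_ge0.
- exact: flip_rate_sum.
- by move=> a b y; rewrite flipC.
(* In exactly one of the two configurations leaf k opposes the hub, and there its flip is always
   accepted. *)
- have [xk|xk] : s x k = - s0 x \/
      s (flip x (lift ord0 k)) k = - s0 (flip x (lift ord0 k)).
  + rewrite !spin_flip eqxx /=.
    by case: (spin_pm R x ord0) => ->; case: (spin_pm R x (lift ord0 k)) => ->;
       rewrite ?opprK; auto.
  + by rewrite (flip_rate_up xk) lerDl flip_rate_ge0.
  + by rewrite (flip_rate_up xk) lerDr flip_rate_ge0.
rewrite big_mkcond big_ord_recl /= add0r.
apply: (@le_trans _ _ (\sum_(j < n) (2 * d)^-1 * (4 / 9 * (4 * `|K k j|)))).
  apply: ler_sum => j _; rewrite (inj_eq lift_inj).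
  (* Leaf j feeds leaf k through [K j k]; symmetry turns this column sum into a row sum. *)
  have -> : K k j = K j k by rewrite -[in LHS]K_sym mxE.
  case: eqVneq => [_|jk] /=; last exact: flip_rate_lipschitz.
  by rewrite !mulr_ge0 ?invr_ge0 // mulr_ge0.
rewrite -!mulr_sumr ler_wpM2l ?invr_ge0 ?mulr_ge0 //.
by have := K_row k; lra.
Qed.

Let mean_stepf A f : mean pi (step (fun i x => flip x i) rate A f) = mean pi f.
Proof. by apply: mean_step; [exact: flipK | exact: flip_rate_balance]. Qed.

Let stepf_sa A : self_adjoint pi (step (fun i x => flip x i) rate A).
Proof. by apply: step_self_adjoint; [exact: flipK | exact: flip_rate_balance]. Qed.

(** Evenness allows replacing y by its antipode, so the hubs may be taken equal and leaf flips
    suffice. *)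
Lemma lip_on_leaves_osc f L x y :
  (forall z, f (antipode z) = f z) -> lip_on_leaves f L ->
  `|f x - f y| <= n%:R * L.
Proof.
move=> f_even fL.
wlog xy0 : y / x ord0 = y ord0 => [main|].
  have [|xy0] := eqVneq (x ord0) (y ord0); first exact: main.
  rewrite -(f_even y); apply: main; rewrite antipodeE.
  by move: xy0; case: (x _); case: (y _).
have -> : n%:R = (size (enum (predC1 (ord0 : 'I_n.+1))))%:R :> R.
  by rewrite -cardE cardC1 card_ord.
apply: osc_le_path => [i z|i]; rewrite mem_enum inE; first exact: fL.
by rewrite negbK => /eqP ->.
Qed.

Lemma nrm_leaf_dynamics f :
  (forall z, f (antipode z) = f z) -> mean pi f = 0 ->
  nrm pi (Q f) <= r ^+ 2 * nrm pi f.
Proof.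
move=> f_even f0.
(* Any finite Lipschitz bound would do, since [nrm_le_decay] removes the prefactor. *)
pose L := \sum_(i : 'I_n.+1) \sum_z `|f (flip z i) - f z|.
have fL : lip_on_leaves f L.
  move=> i z _; rewrite /L (bigD1 i) //= (bigD1 z) //= -addrA lerDl.
  by rewrite addr_ge0 ?sumr_ge0 // => j _; rewrite sumr_ge0.
apply: (@nrm_le_decay _ _ _ (gibbs_ge0 K beta) _ _ _ ((n%:R * L) ^+ 2)) => //.
  by rewrite exprn_gt0 // contraction_rate_gt0.
move=> t; have [E M Lt] : [/\ forall z, iter t Q f (antipode z) = iter t Q f z,
    mean pi (iter t Q f) = 0 & lip_on_leaves (iter t Q f) (r ^+ t * L)].
  elim: t => [|t [E M Lt]]; first by rewrite expr0 mul1r.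
  split=> [z||]; rewrite !iterS.
  - by rewrite step_antipode; congr (step _ _ _ _ z); apply/funext => w /=.
  - by rewrite mean_stepf.
  - by rewrite exprS -mulrA; apply: leaf_dynamics_contracts.
have -> : (n%:R * L) ^+ 2 * (r ^+ 2) ^+ t = (n%:R * (r ^+ t * L)) ^+ 2.
  by rewrite -exprM mulnC exprM; ring.
apply: nrm_le_osc => // [x||x y]; first exact: gibbs_ge0.
  exact: gibbs_sum1.
exact: lip_on_leaves_osc.
Qed.

(** Chain of bounds: nrm (P f) <= <P f, f> <= <Q f, f>, and Cauchy-Schwarz with the factor r^2 for
    nrm (Q f) bounds the last by r nrm f. *)
Lemma nrm_metropolis_even f :
  (forall z, f (antipode z) = f z) -> mean pi f = 0 ->
  nrm pi (P f) <= r * nrm pi f.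
Proof.
move=> f_even f0.
apply: le_trans (nrm_step_le _ _ _ _ _ _ _) _; try first
  [exact: gibbs_ge0 | exact: flipK | exact: flip_rate_ge0
  | exact: flip_rate_balance | exact: flip_rate_sum].
apply: (@le_trans _ _ (dot pi (Q f) f)).
  by apply: dot_step_subset => //; first
    [exact: gibbs_ge0 | exact: flipK | exact: flip_rate_ge0 | exact: flip_rate_balance].
have r_ge0 := ltW contraction_rate_gt0; have N_ge0 := nrm_ge0 (gibbs_ge0 K beta) f.
apply: le_trans (ler_norm _) _.
rewrite -ler_sqr ?nnegrE ?mulr_ge0 // real_normK ?num_real //.
apply: le_trans (cauchy_schwarz (gibbs_ge0 K beta) _ _) _.
rewrite exprMn [_ ^+ 2 * _]mulrC expr2 -mulrA mulrC.
by rewrite ler_wpM2r // mulrC nrm_leaf_dynamics.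
Qed.

Lemma dot_antipode f g :
  dot pi (f \o @antipode n) (g \o @antipode n) = dot pi f g.
Proof.
rewrite [RHS]/dot (reindex_inj (inv_inj (@antipodeK n))) /=.
by apply: eq_bigr => x _; rewrite gibbs_antipode.
Qed.

Lemma nrm_even_odd e o :
  (forall z, e (antipode z) = e z) -> (forall z, o (antipode z) = - o z) ->
  nrm pi (fun z => e z + o z) = nrm pi e + nrm pi o.
Proof.
move=> e_even o_odd.
have eo0 : dot pi e o = 0.
  have : dot pi e o = - dot pi e o.
    rewrite -[LHS]dot_antipode /dot -sumrN; apply: eq_bigr => x _ /=.
    by rewrite e_even o_odd; ring.
  by lra.
have -> : nrm pi (fun z => e z + o z) = nrm pi e + nrm pi o + 2 * dot pi e o.
  rewrite /nrm /dot mulr_sumr -!big_split /=; apply: eq_bigr => x _; ring.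
by rewrite eo0 mulr0 addr0.
Qed.

Definition even_part f : config n -> R := fun z => (f z + f (antipode z)) / 2.
Definition odd_part f : config n -> R := fun z => (f z - f (antipode z)) / 2.

Lemma even_partP f z : even_part f (antipode z) = even_part f z.
Proof. by rewrite /even_part antipodeK addrC. Qed.

Lemma odd_partP f z : odd_part f (antipode z) = - odd_part f z.
Proof. by rewrite /odd_part antipodeK -mulNr opprB. Qed.

Lemma nrm_parts f : nrm pi f = nrm pi (even_part f) + nrm pi (odd_part f).
Proof.
rewrite -nrm_even_odd; [|exact: even_partP|exact: odd_partP].
by congr nrm; apply/funext => z; rewrite /even_part /odd_part; field.
Qed.

Lemma mean_even_part f : mean pi (even_part f) = mean pi f.
Proof.
have E : mean pi (f \o @antipode n) = mean pi f.
  by rewrite !mean_dot -[RHS]dot_antipode.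
have -> : mean pi (even_part f) = (mean pi f + mean pi (f \o @antipode n)) / 2.
  rewrite /mean -big_split mulr_suml /=; apply: eq_bigr => x _.
  by rewrite /even_part; ring.
by rewrite E; field.
Qed.

(** P commutes with the antipode and so preserves parity; the even part contracts, while the odd
    part merely does not grow. *)
Lemma nrm_metropolis f :
  mean pi f = 0 ->
  nrm pi (P f) <= r * nrm pi (even_part f) + nrm pi (odd_part f).
Proof.
move=> f0.
have -> : P f = fun z => P (even_part f) z + P (odd_part f) z.
  apply/funext => x; rewrite /step addrACA -big_split /=; congr (_ + _).
    by rewrite /even_part /odd_part; field.
  by apply: eq_bigr => i _; rewrite /even_part /odd_part; field.
rewrite nrm_even_odd; last first.
- move=> z; rewrite step_antipode /step opprD -sumrN /= odd_partP; congr (_ + _).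
  by apply: eq_bigr => i _ /=; rewrite !odd_partP; ring.
- move=> z; rewrite step_antipode; congr (step _ _ _ _ z).
  by apply/funext => w /=; rewrite even_partP.
apply: lerD.
  by apply: nrm_metropolis_even; [exact: even_partP | rewrite mean_even_part].
by apply: nrm_step_mono; first
  [exact: gibbs_ge0 | exact: flipK | exact: flip_rate_ge0
  | exact: flip_rate_balance | exact: flip_rate_sum].
Qed.

Local Notation PK := (metropolis K beta).
Local Notation GK := (orbit_average R n).
Local Notation rho := (1 - (36 * d)^-1).

Lemma contraction_rates : r <= rho /\ rho = (1 + r) / 2.
Proof.
have := d_gt0; move: d => e e_gt0; split; last by field; rewrite gt_eqF.
by rewrite lerD2l lerN2 lef_pV2 ?posrE ?mulr_gt0 // ler_pM2r //; lra.
Qed.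

(** Orbit averaging is the orthogonal projection onto even functions, so P only ever acts on the
    contracting part. *)
Lemma nrm_GPG f : mean pi f = 0 ->
  nrm pi (act (kmul (kmul GK PK) GK) f) <= rho * nrm pi f.
Proof.
move=> f0; rewrite !act_kmul act_metropolis !act_orbit_average.
rewrite -/(even_part f) -[X in nrm _ X]/(even_part (P (even_part f))).
apply: (@le_trans _ _ (nrm pi (P (even_part f)))).
  by rewrite [leRHS]nrm_parts lerDl nrm_ge0 //; apply: gibbs_ge0.
apply: (@le_trans _ _ (r * nrm pi (even_part f))).
  by apply: nrm_metropolis_even; [exact: even_partP | rewrite mean_even_part].
have [r_rho _] := contraction_rates.
have N_ge0 g := nrm_ge0 (gibbs_ge0 K beta) g.
apply: ler_pM => //; first exact: ltW contraction_rate_gt0.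
by rewrite [leRHS]nrm_parts lerDl.
Qed.

(** By convexity of the square, the even part gets the factor (r + 1)/2 = [rho]. The odd part,
    killed by G, gets at most 1/2 <= [rho]. *)
Lemma nrm_kmean f : mean pi f = 0 ->
  nrm pi (act (kmean PK GK) f) <= rho * nrm pi f.
Proof.
move=> f0; rewrite act_kmean act_metropolis act_orbit_average -/(even_part f).
have N_ge0 g := nrm_ge0 (gibbs_ge0 K beta) g.
apply: (@le_trans _ _ ((nrm pi (P f) + nrm pi (even_part f)) / 2)).
  rewrite /nrm /dot -big_split mulr_suml /=; apply: ler_sum => x _.
  rewrite -(mulrDr (pi x)) -(mulrA (pi x)).
  apply: ler_wpM2l; first exact: gibbs_ge0.
  rewrite -/(even_part f x); move: (P f x) (even_part f x) => p e.
  by have := sqr_ge0 (p - e); rewrite expr2; lra.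
have := nrm_metropolis f0; have [_ ->] := contraction_rates.
have := mulr_ge0 (ltW contraction_rate_gt0) (N_ge0 (odd_part f)).
rewrite [nrm pi f]nrm_parts; move: ((18 * d)^-1) => u.
by have := N_ge0 (even_part f); lra.
Qed.

End UpperBound.

(** * Mixing times: existence and upper bounds *)

Lemma expR1_ge2 (R : realType) : 2 <= expR 1 :> R.
Proof. by have := expR_ge1Dx (1 : R); lra. Qed.

(** From 1 - u <= e^(-u); the summand 2 beside a pays for the factor 1/4, as e^2 >= 4. *)
Lemma powers_small_time (R : realType) (D a : R) : 1 <= D -> 0 <= a ->
  exists2 t : nat, (1 - (36 * D)^-1) ^+ t <= expR (- a) / 4 &
    t%:R <= 36 * D * (a + 2) + 1.
Proof.
move=> D1 a_ge0; set T := 36 * D * (a + 2).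
have T_ge0 : 0 <= T by rewrite /T !mulr_ge0 //; lra.
exists (Num.truncn T).+1; last first.
  by rewrite -natr1 lerD2r Num.Theory.truncn_le.
have D_gt0 : 0 < 36 * D by lra.
set u := (36 * D)^-1.
have u_gt0 : 0 < u by rewrite invr_gt0.
have u_le1 : u <= 1 by rewrite invf_le1 //; lra.
apply: (@le_trans _ _ (expR (- u) ^+ (Num.truncn T).+1)).
  by rewrite lerXn2r ?nnegrE ?expR_ge0 ?subr_ge0 //; exact: expR_ge1Dx.
rewrite -expRM_natl; apply: (@le_trans _ _ (expR (- (a + 2)))).
  rewrite ler_expR mulrN lerN2.
  have -> : a + 2 = T * u by rewrite /T /u; field; rewrite gt_eqF //; lra.
  by rewrite ler_wpM2r ?ltW // truncnS_gt.
rewrite opprD expRD ler_wpM2l ?expR_ge0 // expRN lef_pV2 ?posrE ?expR_gt0 //.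
have -> : (2 : R) = 1 + 1 by [].
rewrite expRD; have := expR1_ge2 R.
move: (expR 1) => e e2; have : 2 * 2 <= e * e by apply: ler_pM.
lra.
Qed.

(** Jensen's inequality: the left side is the b-th power of the average of e^(1/2) and e^(-1/2), the
    right side the average of their b-th powers. *)
Lemma expR_c_star_le (R : realType) (b : R) : 1 <= b ->
  expR (c_star R * b) <= cosh (b / 2).
Proof.
move=> b1.
have C_gt0 : 0 < cosh (1 / 2 : R) by rewrite divr_gt0 // addr_gt0 ?expR_gt0.
set c := c_star R.
have cE : expR c = (expR (1 / 2) + expR (- (1 / 2))) / 2 by rewrite lnK.
(* The tangent-line bound [e^(b u) >= e^u + (b - 1) (e^u - 1)]; summed over the
   two exponents [u = +-1/2 - c], whose exponentials add up to 2, it gives the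
   claim. *)
have tangent u : expR u + (b - 1) * (expR u - 1) <= expR (b * u).
  have -> : b * u = u + (b - 1) * u by ring.
  rewrite expRD; apply: (@le_trans _ _ (expR u * (1 + (b - 1) * u))).
    rewrite [leRHS]mulrDr mulr1 lerD2l mulrCA; apply: ler_wpM2l; first by lra.
    have := ler_wpM2l (expR_ge0 u) (expR_ge1Dx (- u)); rewrite expRxMexpNx_1; lra.
  by rewrite ler_wpM2l ?expR_ge0 //; exact: expR_ge1Dx.
have sum2 : expR (1 / 2 - c) + expR (- (1 / 2) - c) = 2.
  rewrite !expRD expRN -mulrDl cE; field.
  by rewrite gt_eqF // addr_gt0 ?expR_gt0.
have : 2 <= expR (b * (1 / 2 - c)) + expR (b * (- (1 / 2) - c)).
  have := tangent (1 / 2 - c); have := tangent (- (1 / 2) - c).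
  have := sum2; move: (expR (1 / 2 - c)) (expR (- (1 / 2) - c)) => A B AB.
  have -> : A = 2 - B by lra.
  by lra.
have -> : b * (1 / 2 - c) = b / 2 - c * b by field.
have -> : b * (- (1 / 2) - c) = - (b / 2) - c * b by field.
rewrite !expRD -mulrDl (expRN (c * b)) ler_pdivlMr ?expR_gt0 // /cosh; lra.
Qed.

Lemma c_star_gt0 (R : realType) : 0 < c_star R.
Proof.
apply: ln_gt0; rewrite /cosh.
have : (1 / 2 : R) != 0 by rewrite gt_eqF // divr_gt0.
move=> h; have := expR_gt1Dx h; have := expR_ge1Dx (- (1 / 2) : R); lra.
Qed.

Section Bounds.
Variables (R : realType) (n : nat) (K : 'M[R]_n) (beta : R).
Hypothesis K_sym : K^T = K.
Hypothesis K_diag : forall i : 'I_n, K i i = 0.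
Hypothesis K_row : forall i : 'I_n, \sum_j `|K i j| <= 1 / 2.
Hypothesis beta_ge1 : 1 <= beta.
Implicit Types (x y z : config n) (k : 'I_n) (f : config n -> R).

Local Notation H := (hamiltonian K).
Local Notation pi := (gibbs K beta).
Local Notation d := (n.+1%:R : R).
Local Notation rate := (flip_rate K beta).
Local Notation P := (step (fun i x => flip x i) rate predT).
Local Notation PK := (metropolis K beta).
Local Notation GK := (orbit_average R n).
Local Notation s x k := (spin R x (lift ord0 k)).
Local Notation s0 x := (spin R x ord0).

Let beta_ge0 : 0 <= beta. Proof. exact: le_trans ler01 beta_ge1. Qed.

Lemma norm_hamiltonian_le x : `|H x| <= 2 * d.
Proof.
have a : `|\sum_k s x k| <= n%:R.
  apply: le_trans (ler_norm_sum _ _ _) _.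
  under eq_bigr do rewrite normr_spin.
  by rewrite sumr_const card_ord.
have b : `|\sum_k s x k * coupling K x k| <= n%:R.
  apply: le_trans (ler_norm_sum _ _ _) _.
  rewrite -[n in n%:R]card_ord -sumr_const; apply: ler_sum => k _.
  by rewrite normrM normr_spin mul1r; have := norm_coupling_le K_row x k; lra.
rewrite hamiltonianE interactionE //; apply: le_trans (ler_normB _ _) _.
rewrite normrN !normrM normr_spin mul1r [`|2^-1|]ger0_norm ?invr_ge0 //.
have : 0 <= n%:R :> R by [].
by rewrite -(natr1 n); move: a b; lra.
Qed.

Local Notation p := (expR (- (5 * beta * d))).

(** The numerator is at least e^(-2 beta d), and the partition function at most 2^d e^(2 beta d)
    with 2 <= e^beta; together this gives the 5. *)
Lemma gibbs_lower_bound x : p <= pi x.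
Proof.
have Hle y : - (2 * beta * d) <= - beta * H y <= 2 * beta * d.
  have := norm_hamiltonian_le y; rewrite ler_norml => /andP[lo up].
  have := ler_wpM2l beta_ge0 up; have := ler_wpM2l beta_ge0 lo.
  by move=> h1 h2; apply/andP; split; lra.
have Z_le : partition_function K beta <= expR (beta * d) * expR (2 * beta * d).
  apply: (@le_trans _ _ (\sum_(x : config n) expR (2 * beta * d))).
    by apply: ler_sum => y _; rewrite ler_expR; have /andP[] := Hle y.
  rewrite sumr_const card_ffun card_bool card_ord -(mulr_natl (expR _)).
  rewrite ler_wpM2r ?expR_ge0 // natrX expRM_natr lerXn2r ?nnegrE ?expR_ge0 //.
  by have := expR_ge1Dx beta; have := beta_ge1; lra.
rewrite /gibbs ler_pdivlMr ?partition_gt0 //.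
apply: (@le_trans _ _ (p * (expR (beta * d) * expR (2 * beta * d)))).
  by rewrite ler_wpM2l ?expR_ge0.
rewrite -!expRD ler_expR.
have /andP[lo _] := Hle x; apply: le_trans lo.
by rewrite le_eqVlt; apply/orP; left; apply/eqP; ring.
Qed.

Let mean_stepf A f : mean pi (step (fun i x => flip x i) rate A f) = mean pi f.
Proof. by apply: mean_step; [exact: flipK | exact: flip_rate_balance]. Qed.

Lemma act_orbit_average_cst a : act GK (fun=> a) = fun=> a.
Proof. by rewrite act_orbit_average; apply/funext => x; field. Qed.

Lemma mean_orbit_average f : mean pi (act GK f) = mean pi f.
Proof. by rewrite act_orbit_average; exact: mean_even_part. Qed.

Lemma mean_kmean f : mean pi (act (kmean PK GK) f) = mean pi f.
Proof.
transitivity ((mean pi (act PK f) + mean pi (act GK f)) / 2).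
  rewrite act_kmean /mean -big_split mulr_suml; apply: eq_bigr => x _ /=.
  by ring.
by rewrite mean_orbit_average act_metropolis mean_stepf; field.
Qed.

Lemma symmetrized_mixing_time (T : kernel R (config n)) :
  (forall a, act T (fun=> a) = fun=> a) ->
  (forall f, mean pi (act T f) = mean pi f) ->
  (forall f, mean pi f = 0 ->
     nrm pi (act T f) <= (1 - (36 * d)^-1) * nrm pi f) ->
  exists2 t, is_mixing_time T pi (1 / 4) t &
    t%:R <= 200 * d ^+ 2 * (1 + beta).
Proof.
move=> T1 Tmean Tnrm.
have d1 : 1 <= d by rewrite ler1n.
have a_ge0 : 0 <= 5 * beta * d by rewrite !mulr_ge0.
have [t small t_le] := powers_small_time d1 a_ge0.
have [|u u_mix ut] := @exists_mixing_time _ _ T pi (1 / 4) t.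
  apply: worst_dTV_le_contraction small => //.
  - exact: gibbs_ge0.
  - exact: gibbs_sum1.
  - by rewrite subr_ge0 invf_le1; lra.
  - exact: expR_gt0.
  - exact: gibbs_lower_bound.
exists u => //; apply: (@le_trans _ _ t%:R); first by rewrite ler_nat.
apply: le_trans t_le _.
have dd : d <= d ^+ 2 by rewrite expr2 ler_peMl.
have dd1 : 1 <= d ^+ 2 by rewrite exprn_ege1.
have bd : 0 <= beta * d ^+ 2 by rewrite mulr_ge0 // exprn_ge0.
(* Since d >= 1, the lower-order part 72 d + 1 is at most 73 d^2, well within 200 d^2. *)
have -> : 36 * d * (5 * beta * d + 2) + 1 = 180 * (beta * d ^+ 2) + 72 * d + 1.
  by ring.
have -> : 200 * d ^+ 2 * (1 + beta) = 200 * d ^+ 2 + 200 * (beta * d ^+ 2).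
  by ring.
move: dd dd1 bd; move: (beta * d ^+ 2) (d ^+ 2) => u1 u2; lra.
Qed.

Lemma mixing_time_GPG :
  exists2 t, is_mixing_time (kmul (kmul GK PK) GK) pi (1 / 4) t &
    t%:R <= 200 * d ^+ 2 * (1 + beta).
Proof.
apply: symmetrized_mixing_time => [a|f|f].
- by rewrite !act_kmul act_orbit_average_cst act_metropolis step_cst
             act_orbit_average_cst.
- by rewrite !act_kmul mean_orbit_average act_metropolis mean_stepf
             mean_orbit_average.
- exact: nrm_GPG.
Qed.

Lemma mixing_time_kmean :
  exists2 t, is_mixing_time (kmean PK GK) pi (1 / 4) t &
    t%:R <= 200 * d ^+ 2 * (1 + beta).
Proof.
apply: symmetrized_mixing_time => [a|f|f].
- rewrite act_kmean act_orbit_average_cst act_metropolis step_cst.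
  by apply/funext => x; field.
- exact: mean_kmean.
- exact: nrm_kmean.
Qed.

(* Irreducibility alone: the gap obtained here is exponentially small in d. *)
Lemma exists_mixing_time_metropolis :
  exists t, is_mixing_time PK pi (1 / 4) t.
Proof.
have p_gt0 : 0 < p by apply: expR_gt0.
have p_le1 : p <= 1 by rewrite expR_le1 oppr_le0 !mulr_ge0.
have d1 : 1 <= d by rewrite ler1n.
(* A lower bound for the stationary flow across every edge. *)
set kappa := (2 * d)^-1 * p.
have kappa_gt0 : 0 < kappa by rewrite mulr_gt0 // invr_gt0 mulr_gt0.
have kappa_lt1 : kappa < 1.
  apply: (@le_lt_trans _ _ (2 * d)^-1); last by rewrite invf_lt1; lra.
  by rewrite ler_piMr // invr_ge0 mulr_ge0.
have kappa_le i x : kappa <= pi x * rate i x.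
  rewrite gibbs_flip_rate ler_wpM2l ?invr_ge0 ?mulr_ge0 //.
  by rewrite le_min !gibbs_lower_bound.
(* The Poincare inequality nrm f <= d^2 D / kappa, proved below along paths of flips, is set against
   the loss of D / 2 per step. *)
set q := 1 - kappa / (2 * d ^+ 2).
have d2 : 1 <= d ^+ 2 by rewrite exprn_ege1.
have q01 : 0 < q < 1.
  have : 0 < kappa / (2 * d ^+ 2) by rewrite divr_gt0 // mulr_gt0 // exprn_gt0.
  have : kappa / (2 * d ^+ 2) < 1.
    rewrite ltr_pdivrMr ?mulr_gt0 ?exprn_gt0 //; apply: lt_le_trans kappa_lt1 _.
    by lra.
  by rewrite /q; move: (kappa / _) => v h1 h2; apply/andP; split; lra.
have /andP[q_gt0 q_lt1] := q01.
have [t] := @geometric_unbounded R q^-1 (4 / p) (ltac:(by rewrite invf_gt1)).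
rewrite exprVn => t_big.
have small : q ^+ t <= p / 4.
  rewrite -[p / 4]invrK invf_div ltW // -[ltLHS]invrK ltf_pV2 ?posrE //.
    by rewrite invr_gt0 exprn_gt0.
  by rewrite divr_gt0.
have [|u u_mix _] := @exists_mixing_time _ _ PK pi (1 / 4) t; last by exists u.
apply: worst_dTV_le_contraction small => //.
- exact: gibbs_ge0.
- exact: gibbs_sum1.
- by move=> a; rewrite act_metropolis step_cst.
- by move=> f; rewrite act_metropolis mean_stepf.
- exact: ltW.
- move=> f f0; rewrite act_metropolis.
  set D := dirichlet pi (fun i x => flip x i) rate predT f f.
  have D_ge0 : 0 <= D by apply: dirichlet_ge0; [exact: gibbs_ge0 | exact: flip_rate_ge0].
  have Dk_ge0 : 0 <= D / kappa by rewrite divr_ge0 // ltW.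
  have grad i x : `|f (flip x i) - f x| <= Num.sqrt (D / kappa).
    rewrite -ler_sqr ?nnegrE ?sqrtr_ge0 // sqr_sqrtr // real_normK ?num_real //.
    rewrite ler_pdivlMr //.
    apply: (@le_trans _ _
      (pi x * (rate i x * ((f (flip x i) - f x) * (f (flip x i) - f x))))).
      by rewrite mulrC mulrA -expr2 ler_wpM2r ?sqr_ge0.
    rewrite /D /dirichlet (bigD1 i) //= (bigD1 x) //= -addrA lerDl addr_ge0 //.
      apply: sumr_ge0 => y _; rewrite mulr_ge0 ?gibbs_ge0 //.
      by rewrite mulr_ge0 ?flip_rate_ge0 // -expr2 sqr_ge0.
    apply: sumr_ge0 => j _; apply: sumr_ge0 => y _.
    rewrite mulr_ge0 ?gibbs_ge0 //.
    by rewrite mulr_ge0 ?flip_rate_ge0 // -expr2 sqr_ge0.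
  have : nrm pi f <= (d * Num.sqrt (D / kappa)) ^+ 2.
    apply: nrm_le_osc => // [x||x y]; first exact: gibbs_ge0.
      exact: gibbs_sum1.
    rewrite -[n.+1 in leRHS]card_ord cardE; apply: osc_le_path => [i z _|i].
      exact: grad.
    by rewrite mem_enum.
  rewrite exprMn sqr_sqrtr //.
  move=> poincare.
  apply: le_trans (nrm_step_le _ _ _ _ _ _ _) _; try first
    [exact: gibbs_ge0 | exact: flipK | exact: flip_rate_ge0
    | exact: flip_rate_balance | exact: flip_rate_sum].
  rewrite dot_step; [|exact: flipK|exact: flip_rate_balance].
  rewrite -/D -/(nrm pi f) /q mulrBl mul1r lerD2l lerN2.
  have -> : D / 2 = kappa / (2 * d ^+ 2) * (d ^+ 2 * (D / kappa)).
    by field; rewrite ?gt_eqF //; lra.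
  by rewrite ler_wpM2l // divr_ge0 ?(ltW kappa_gt0) // mulr_ge0 // exprn_ge0.
- exact: gibbs_lower_bound.
Qed.

End Bounds.

(** * Slow mixing of the Metropolis chain *)

Section LowerBound.
Variables (R : realType) (n : nat) (K : 'M[R]_n) (beta : R).
Hypothesis n_gt0 : (0 < n)%N.
Hypothesis K_sym : K^T = K.
Hypothesis K_diag : forall i : 'I_n, K i i = 0.
Hypothesis K_row : forall i : 'I_n, \sum_j `|K i j| <= 1 / 2.
Hypothesis beta_ge1 : 1 <= beta.
Implicit Types (x y z : config n) (k : 'I_n) (f : config n -> R).

Local Notation H := (hamiltonian K).
Local Notation pi := (gibbs K beta).
Local Notation d := (n.+1%:R : R).
Local Notation rate := (flip_rate K beta).
Local Notation P := (step (fun i x => flip x i) rate predT).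
Local Notation PK := (metropolis K beta).
Local Notation s x k := (spin R x (lift ord0 k)).
Local Notation s0 x := (spin R x ord0).

Let beta_ge0 : 0 <= beta. Proof. exact: le_trans ler01 beta_ge1. Qed.

(* Interpolates between the field beta / 2 on every leaf (m = 0) and the field
   beta on every leaf (m = n), which is minus beta times the Hamiltonian. *)
Definition field_energy (m : nat) x : R :=
  beta * interaction K x + beta / 2 * (s0 x * \sum_k s x k) +
  beta / 2 * (s0 x * \sum_(k < n | (k < m)%N) s x k).

Definition field_weight m : R := \sum_x expR (field_energy m x).

(** Flipping the hub reverses the field and keeps the interaction; averaging both forms uses e^S +
    e^(-S) >= 2. *)
Lemma field_weight0_ge :
  \sum_x expR (beta * interaction K x) <= field_weight 0.
Proof.
pose S x := beta / 2 * (s0 x * \sum_k s x k).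
have E x : field_energy 0 x = beta * interaction K x + S x.
  by rewrite /field_energy [X in _ + _ * (_ * X)]big_pred0 // !mulr0 addr0.
have F : field_weight 0 = \sum_x expR (beta * interaction K x - S x).
  rewrite /field_weight (reindex_inj (inv_inj (flipK ord0))) /=.
  apply: eq_bigr => x _; rewrite E interaction_flip0 /S spin_flip eqxx.
  under [X in expR (_ + _ * (_ * X))]eq_bigr do rewrite spin_flip /=.
  by congr expR; ring.
have : \sum_x 2 * expR (beta * interaction K x) <= field_weight 0 + field_weight 0.
  rewrite {2}F /field_weight -big_split /=; apply: ler_sum => x _.
  rewrite E !expRD -mulrDr [leLHS]mulrC ler_wpM2l ?expR_ge0 //.
  by have := expR_ge1Dx (S x); have := expR_ge1Dx (- S x); lra.
by rewrite -mulr_sumr; lra.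
Qed.

Lemma sum_ltS (F : 'I_n -> R) k :
  \sum_(j < n | (j < k.+1)%N) F j = \sum_(j < n | (j < k)%N) F j + F k.
Proof.
rewrite (bigD1 k) //= addrC; congr (_ + _); apply: eq_bigl => j.
by rewrite ltnS [in RHS]ltn_neqAle andbC.
Qed.

(* The field beta / 2 already present dominates the coupling, whose total
   strength is at most beta / 2, so the magnetization of every leaf along the
   hub is nonnegative. *)
Lemma field_magnetization_ge0 k :
  0 <= \sum_x expR (field_energy k x) * (s0 x * s x k).
Proof.
set M := \sum_x _.
have ME : M = \sum_x expR (field_energy k (flip x (lift ord0 k))) *
                     - (s0 x * s x k).
  rewrite /M (reindex_inj (inv_inj (flipK (lift ord0 k)))) /=.
  by apply: eq_bigr => x _; rewrite !spin_flip eqxx /= mulrN.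
suff : 0 <= M + M by lra.
(* Each pair differing at leaf k contributes nonnegatively, as the configuration with the leaf
   aligned has the larger weight. *)
rewrite {2}ME /M -big_split /=; apply: sumr_ge0 => x _.
set x' := flip x _.
have DE : field_energy k x - field_energy k x' =
    beta * (2 * s x k * coupling K x k) + beta * (s0 x * s x k).
  rewrite /field_energy interaction_flip // /x' spin_flip /=.
  under [X in _ - (_ + _ * (_ * X) + _)]eq_bigr do
    rewrite spin_flip_site -[X in _ + X]mul1r.
  rewrite big_split /= (sum_delta (fun=> 1)).
  (* Leaf k is not among the leaves j < k, so the extra field does not see its flip. *)
  under [X in _ - (_ + _ * (_ * X))]eq_bigr => j jk.
    rewrite spin_flip_site.
    have -> : (j == k) = false by apply/negbTE; rewrite neq_ltn jk.
    rewrite mul0r addr0.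
    over.
  by field.
have := norm_coupling_le K_row x k; rewrite ler_norml => /andP[lo up].
rewrite mulrN -mulrBl.
have D_ge0 : 0 <= (s0 x * s x k) * (field_energy k x - field_energy k x').
  rewrite DE -mulrDr mulrCA mulr_ge0 //.
  by case: (spin_pm R x ord0) => ->; case: (spin_pm R x (lift ord0 k)) => ->; lra.
have [E|E] : s0 x * s x k = 1 \/ s0 x * s x k = -1.
- by case: (spin_pm R x ord0) => ->; case: (spin_pm R x (lift ord0 k)) => ->;
     rewrite ?mulN1r ?mul1r ?opprK; auto.
- move: D_ge0; rewrite E mul1r mulr1 !subr_ge0.
  by rewrite ler_expR.
- move: D_ge0; rewrite E mulN1r mulrN1 !oppr_ge0 !subr_le0.
  by rewrite ler_expR.
Qed.

(** For a sign s, e^(b s) = cosh b + s sinh b; the sinh term multiplies the magnetization of leaf k,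
    which is nonnegative. *)
Lemma field_weightS k : cosh (beta / 2) * field_weight k <= field_weight k.+1.
Proof.
pose sh := (expR (beta / 2) - expR (- (beta / 2))) / 2.
have sh_ge0 : 0 <= sh.
  rewrite divr_ge0 // subr_ge0 ler_expR.
  by rewrite -subr_ge0 opprK addr_ge0 // divr_ge0.
have -> : field_weight k.+1 = cosh (beta / 2) * field_weight k +
    sh * \sum_x expR (field_energy k x) * (s0 x * s x k).
  rewrite /field_weight !mulr_sumr -big_split /=; apply: eq_bigr => x _.
  have -> : field_energy k.+1 x = field_energy k x + beta / 2 * (s0 x * s x k).
    by rewrite /field_energy sum_ltS; ring.
  rewrite expRD /sh /cosh.
  have [->|->] : s0 x * s x k = 1 \/ s0 x * s x k = -1.
  - by case: (spin_pm R x ord0) => ->; case: (spin_pm R x (lift ord0 k)) => ->;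
       rewrite ?mulN1r ?mul1r ?opprK; auto.
  - by rewrite mulr1; field.
  - by rewrite mulrN1; field.
by rewrite lerDl mulr_ge0 // field_magnetization_ge0.
Qed.

Lemma field_weight_ge :
  cosh (beta / 2) ^+ n * \sum_x expR (beta * interaction K x) <=
  partition_function K beta.
Proof.
have cosh_ge0 : 0 <= cosh (beta / 2) by rewrite divr_ge0 // addr_ge0 ?expR_ge0.
have -> : partition_function K beta = field_weight n.
  apply: eq_bigr => x _; congr expR; rewrite hamiltonianE /field_energy.
  rewrite [X in _ + _ * (_ * X)](eq_bigl predT) => [|j]; last by rewrite ltn_ord.
  by field.
suff main m : (m <= n)%N ->
    cosh (beta / 2) ^+ m * \sum_x expR (beta * interaction K x) <= field_weight m.
  exact: main.
elim: m => [|m IH] mn; first by rewrite expr0 mul1r field_weight0_ge.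
apply: le_trans (field_weightS (Ordinal mn)) => /=.
by rewrite exprS -mulrA ler_wpM2l // IH // ltnW.
Qed.

Local Notation q := (expR (- (c_star R * beta * n%:R))).

(* min(1, a^2) <= a turns the acceptance probability of a hub flip into the
   removal of the whole field. *)
Lemma hub_acceptance_le :
  \sum_x pi x * Num.min 1 (expR (- beta * (H (flip x ord0) - H x))) <= q.
Proof.
set Z0 := \sum_x expR (beta * interaction K x).
apply: (@le_trans _ _ (Z0 / partition_function K beta)).
  rewrite mulr_suml; apply: ler_sum => x _.
  rewrite /gibbs mulrAC ler_wpM2r ?invr_ge0 ?(ltW (partition_gt0 _ _)) //.
  rewrite hamiltonian_flip0 hamiltonianE.
  set S := s0 x * _.
  have -> : - beta * (- S - interaction K x) = beta * interaction K x + beta * S.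
    by ring.
  rewrite expRD -mulrA ler_piMr ?expR_ge0 //.
  have -> : - beta * (2 * S) = - (beta * S) + - (beta * S) by ring.
  rewrite expRD; have := expRxMexpNx_1 (beta * S).
  have := expR_gt0 (beta * S); have := expR_gt0 (- (beta * S)).
  move: (expR (beta * S)) (expR (- (beta * S))) => a b b_gt0 a_gt0 ab1.
  have [b1|b1] := leP 1 b.
    apply: (@le_trans _ _ a); first by rewrite ler_piMr ?(ltW a_gt0) // ge_min lexx.
    by rewrite -ab1 ler_peMr // ltW.
  apply: (@le_trans _ _ (a * (b * b))).
    by rewrite ler_wpM2l ?(ltW a_gt0) // ge_min lexx orbT.
  by rewrite mulrA ab1 mul1r ltW.
rewrite ler_pdivrMr ?partition_gt0 //.
apply: le_trans (ler_wpM2l (expR_ge0 _) field_weight_ge).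
rewrite -/Z0 mulrA -[leLHS]mul1r.
have Z0_ge0 : 0 <= Z0 by apply: sumr_ge0 => x _; apply: expR_ge0.
rewrite ler_wpM2r // expRN -ler_pdivrMl ?invr_gt0 ?expR_gt0 // invrK mulr1.
rewrite expRM_natr lerXn2r ?nnegrE ?expR_ge0 //.
  by rewrite divr_ge0 // addr_ge0 ?expR_ge0.
exact: expR_c_star_le.
Qed.

Lemma mean_hub : mean pi (fun x => s0 x) = 0.
Proof.
have E : mean pi (fun x => s0 x) = - mean pi (fun x => s0 x).
  rewrite {1}/mean (reindex_inj (inv_inj (@antipodeK n))) /= /mean -sumrN.
  by apply: eq_bigr => x _; rewrite gibbs_antipode spin_antipode mulrN.
by lra.
Qed.

Lemma nrm_hub : nrm pi (fun x => s0 x) = 1.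
Proof.
rewrite /nrm /dot -[RHS](gibbs_sum1 K beta); apply: eq_bigr => x _.
by case: (spin_pm R x ord0) => ->; rewrite ?mulrNN !mulr1.
Qed.

(** Only hub flips change s_0, by 2 in absolute value: 4 * 1/(2d) * 1/2 = 1/d multiplies the mean
    acceptance. *)
Lemma dot_metropolis_hub_ge : 1 - q / d <= dot pi (P (fun x => s0 x)) (fun x => s0 x).
Proof.
rewrite dot_step; [|exact: flipK|exact: flip_rate_balance].
rewrite -/(nrm pi _) nrm_hub lerD2l lerN2 /dirichlet (bigD1 ord0) //=.
rewrite [X in _ + X]big1 ?addr0 => [|i i0]; last first.
  apply: big1 => x _; rewrite spin_flip eq_sym (negbTE i0) subrr.
  by rewrite !mulr0.
apply: le_trans (ler_wpM2r _ hub_acceptance_le); last by rewrite invr_ge0.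
rewrite !mulr_suml; apply: ler_sum => x _.
rewrite /flip_rate /metropolis_rate spin_flip eqxx invfM.
move: (Num.min _ _) => a; rewrite le_eqVlt; apply/orP; left; apply/eqP.
have : d != 0 by rewrite pnatr_eq0.
by case: (spin_pm R x ord0) => ->; move: (d) => e e_neq0; field.
Qed.

Lemma metropolis_mixing_time_ge t : worst_dTV PK pi t <= 1 / 4 ->
  (d - 1) * ln 2 * expR (c_star R * beta * (d - 1)) <= t%:R.
Proof.
move=> mixed; set g := q / d.
have d2 : 2 <= d by rewrite (ler_nat R 2).
have d_gt0 : 0 < d by [].
have q_gt0 : 0 < q by apply: expR_gt0.
have q_le1 : q <= 1.
  by rewrite expR_le1 oppr_le0 !mulr_ge0 // ltW // c_star_gt0.
have g_gt0 : 0 < g by rewrite divr_gt0.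
have g_le : g <= 1 / 2 by rewrite ler_pdivrMr //; lra.
have P_sa : self_adjoint pi (act PK).
  move=> h1 h2; rewrite !act_metropolis.
  by apply: step_self_adjoint; [exact: flipK | exact: flip_rate_balance].
pose f x := s0 x.
have one_step : (1 - g) ^+ 2 * nrm pi f <= nrm pi (act PK f).
  rewrite act_metropolis nrm_hub mulr1.
  apply: (@le_trans _ _ (dot pi (P f) f ^+ 2)).
    have := dot_metropolis_hub_ge; rewrite -/g -/f => h.
    by rewrite lerXn2r ?nnegrE //; lra.
  have := cauchy_schwarz (gibbs_ge0 K beta) (P f) f.
  by rewrite nrm_hub mulr1.
have g1_ge0 : 0 <= (1 - g) ^+ 2 by apply: sqr_ge0.
have lower := nrm_iter_ge (gibbs_ge0 K beta) t P_sa g1_ge0 one_step.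
(* Distance at most 1/4 bounds the mean-zero observable by 1/2 at every point. *)
have upper : nrm pi (iter t (act PK) f) <= (1 / 2) ^+ 2.
  have -> : (1 / 2) ^+ 2 = \sum_x pi x * (1 / 2) ^+ 2.
    by rewrite -mulr_suml gibbs_sum1 !mul1r.
  apply: ler_sum => x _.
  rewrite ler_wpM2l ?gibbs_ge0 // -expr2 -[leLHS]real_normK ?num_real //.
  rewrite lerXn2r ?nnegrE ?divr_ge0 //.
  have f1 y : `|f y| <= 1 by rewrite normr_spin.
  apply: le_trans (act_kpow_le_dTV PK t x mean_hub f1) _.
  by apply: le_trans (ler_wpM2l _ mixed) _ => //; lra.
have half : (1 - g) ^+ t <= 1 / 2.
  rewrite -ler_sqr ?nnegrE ?exprn_ge0 //; try lra.
  by apply: le_trans upper; apply: le_trans lower; rewrite nrm_hub mulr1 -!exprM mulnC.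
have g1_gt0 : 0 < 1 - g by lra.
(* Uses 1/(1 - g) = 1 + g/(1 - g) <= e^(g/(1 - g)). *)
have ln_le : ln 2 <= t%:R * (g / (1 - g)).
  rewrite -ler_expR lnK ?posrE // expRM_natl.
  rewrite -[2]invrK -[leRHS]invrK lef_pV2 ?posrE ?invr_gt0 ?exprn_gt0 ?expR_gt0 //.
  rewrite -exprVn -[2^-1]mul1r; apply: le_trans half.
  rewrite lerXn2r ?nnegrE ?invr_ge0 ?expR_ge0 //; first by lra.
  rewrite -[leRHS]invrK lef_pV2 ?posrE ?invr_gt0 ?expR_gt0 //.
  apply: le_trans (expR_ge1Dx _); rewrite le_eqVlt; apply/orP; left; apply/eqP.
  by field; rewrite gt_eqF.
have dn : d - 1 = n%:R by rewrite -natr1 addrK.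
rewrite dn -[X in expR X]opprK [expR (- - _)]expRN -dn.
(* Here (1 - g)/g = (d - q)/q >= (d - 1)/q, because q <= 1; this is the source of the factor d -
   1. *)
apply: (@le_trans _ _ (ln 2 * ((1 - g) / g))).
  have ln2 : 0 <= ln 2 :> R by apply: ln_ge0; lra.
  rewrite mulrAC mulrC ler_wpM2l // /g.
  have odds (a b : R) : 0 < a -> 0 < b -> (1 - a / b) / (a / b) = (b - a) / a.
    by move=> a_gt0 b_gt0; field; rewrite !gt_eqF.
  rewrite odds //.
  by rewrite dn ler_pM2r ?invr_gt0 //; move: dn q_le1; lra.
rewrite -ler_pdivlMr ?divr_gt0 //; apply: le_trans ln_le _.
by rewrite invf_div.
Qed.

End LowerBound.

Theorem mainTheorem2 (R : realType) :
  0 < c_star R /\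
  exists C : R, 0 < C /\
    forall (n : nat) (K : 'M[R]_n) (beta : R),
      (3 <= n.+1)%N ->
      K^T = K ->
      (forall i : 'I_n, K i i = 0) ->
      \big[Num.max/0]_(i < n) (\sum_(j < n | j != i) `|K i j|) <= 1 / 2 ->
      1 <= beta ->
      let d : R := n.+1%:R in
      let P := metropolis K beta in
      let G := orbit_average R n in
      let mu := gibbs K beta in
      exists t tGPG tmean : nat,
        [/\ is_mixing_time P mu (1 / 4) t,
            is_mixing_time (kmul (kmul G P) G) mu (1 / 4) tGPG,
            is_mixing_time (kmean P G) mu (1 / 4) tmean,
            (d - 1) * ln 2 * expR (c_star R * beta * (d - 1)) <= t%:R
          & Num.max tGPG%:R tmean%:R <= C * d ^+ 2 * (1 + beta)].
Proof.
split; first exact: c_star_gt0.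
exists 200; split=> // n K beta n_ge2 K_sym K_diag K_max beta_ge1 /=.
(* The zero diagonal lets the full row sum replace the sum over j != i. *)
have K_row i : \sum_j `|K i j| <= 1 / 2.
  apply: le_trans K_max; rewrite (bigD1 i) //= K_diag normr0 add0r.
  exact: (le_bigmax_cond _ (fun i => \sum_(j < n | j != i) `|K i j|)).
have [t t_mix] := exists_mixing_time_metropolis K_sym K_diag K_row beta_ge1.
have [u u_mix u_le] := mixing_time_GPG K_sym K_diag K_row beta_ge1.
have [v v_mix v_le] := mixing_time_kmean K_sym K_diag K_row beta_ge1.
exists t, u, v; split=> //; last by rewrite ge_max u_le.
have n_gt0 : (0 < n)%N by case: (n) n_ge2.
have [t_le _] := t_mix.
exact: (metropolis_mixing_time_ge n_gt0 K_sym K_diag K_row beta_ge1 t_le).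
Qed.
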